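(* Let $C$ be a binary completely regular code of length $m$ (i.e. a subset of the vertex set $\mathbb{F}_2^m$ of the binary Hamming graph $\Gamma_m$) with minimum distance $\delta$. (a) If $(m,\delta)=(16,6)$, then $C$ is equivalent to the Nordstrom-Robinson code $\mathcal{NR}$. (b) If $(m,\delta)=(15,5)$, then $C$ is equivalent to the punctured Nordstrom-Robinson code $\mathcal{PN}$. Moreover, the codes $C$ in (a) and (b) are completely transitive.
   Context: The binary Hamming graph $\Gamma_m$ has vertex set $\mathbb{F}_2^m$, two vertices adjacent iff they differ in exactly one coordinate; $d(\alpha,\beta)$ is the Hamming distance and $\Gamma_{m,k}(\alpha)$ the set of vertices at distance $k$ from $\alpha$. $\mathrm{Aut}(\Gamma_m)=T\rtimes L$, where $T$ is the group of translations $\beta\mapsto\beta+\alpha$ of $\mathbb{F}_2^m$ and $L\cong S_m$ is the group of coordinate permutations. Two codes $C,C'\subseteq\mathbb{F}_2^m$ are equivalent if $C^x=C'$ for some $x\in\mathrm{Aut}(\Gamma_m)$. For a code $C$, $d(\gamma,C)=\min_{\beta\in C}d(\gamma,\beta)$, the covering radius $\rho$ is the maximum of $d(\gamma,C)$ over $\gamma\in\mathbb{F}_2^m$, and $C_i=\{\gamma: d(\gamma,C)=i\}$; $\{C=C_0,C_1,\dots,C_\rho\}$ is the distance partition. $C$ is completely regular if for every $i$ and $k$ the number $|\Gamma_{m,k}(\gamma)\cap C|$ is the same for all $\gamma\in C_i$. $C$ is completely transitive if there is a subgroup $X\le\mathrm{Aut}(\Gamma_m)$ such that each $C_i$ is an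 $X$-orbit. The minimum distance is the least distance between distinct codewords. Nordstrom-Robinson code: let $\mathcal{G}$ be the $[24,12,8]$ extended binary Golay code in $\mathbb{F}_2^{24}$, chosen so that $(1^8,0^{16})\in\mathcal{G}$. Let $J^*=\{1,\dots,8\}$ and $J=\{9,\dots,24\}$. Let $\mathcal{D}^0=\{\alpha\in\mathcal{G}:\mathrm{supp}(\alpha)\cap J^*=\emptyset\}$ and, for $1\le i\le 7$, $\mathcal{D}^i=\{\alpha\in\mathcal{G}:\mathrm{supp}(\alpha)\cap J^*=\{i,8\}\}$. Let $\mathcal{B}=\bigcup_{i=0}^7\mathcal{D}^i$. Then $\mathcal{NR}\subseteq\mathbb{F}_2^{16}$ is the set of restrictions of the vectors in $\mathcal{B}$ to the coordinates in $J$ (a $(16,256,6)$ code). The punctured Nordstrom-Robinson code $\mathcal{PN}\subseteq\mathbb{F}_2^{15}$ is obtained from $\mathcal{NR}$ by deleting the first coordinate of every codeword. *)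

(* Defs.v *)
From mathcomp Require Import all_boot all_order all_fingroup.
Set Implicit Arguments.
Unset Strict Implicit.
Unset Printing Implicit Defensive.

(* Vertices of the binary Hamming graph Gamma_m: vectors of F_2^m,
   represented as boolean functions on the coordinate set 'I_m
   (coordinate k+1 of the paper is the ordinal k). *)
Definition word (m : nat) := {ffun 'I_m -> bool}.

Definition wadd m (a b : word m) : word m := [ffun i => xorb (a i) (b i)].

Definition hd m (a b : word m) : nat := #|[set i | a i != b i]|.

Definition sphere m (k : nat) (a : word m) : {set word m} :=
  [set b | hd a b == k].

Definition wperm m (s : {perm 'I_m}) (b : word m) : word m :=
  [ffun i => b (s i)].

(* Aut(Gamma_m) = T x| L, as a subgroup of Sym(F_2^m): the maps
   beta |-> beta^sigma + alpha. *)
Definition HAut m : {set {perm word m}} :=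
  [set p : {perm word m} | [exists a : word m, exists s : {perm 'I_m},
             [forall b, p b == wadd (wperm s b) a]]].

Definition equivalent m (C C' : {set word m}) : Prop :=
  exists2 x, x \in HAut m & [set x c | c in C] = C'.

(* d(gamma, C) = min over beta in C of d(gamma, beta)
   (the default value m is only reached for C empty) *)
Definition dcode m (C : {set word m}) (g : word m) : nat :=
  \big[minn/m]_(b in C) hd g b.

Definition cov_radius m (C : {set word m}) : nat :=
  \max_(g : word m) dcode C g.

Definition dpart m (C : {set word m}) (i : nat) : {set word m} :=
  [set g | dcode C g == i].

Definition completely_regular m (C : {set word m}) : Prop :=
  forall i k (g1 g2 : word m), g1 \in dpart C i -> g2 \in dpart C i ->
    #|sphere k g1 :&: C| = #|sphere k g2 :&: C|.

Definition completely_transitive m (C : {set word m}) : Prop :=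
  exists2 X : {group {perm word m}}, X \subset HAut m &
    forall i, i <= cov_radius C -> exists g, dpart C i = orbit 'P X g.

Definition min_dist m (C : {set word m}) (d : nat) : Prop :=
  (exists b1, exists b2, [/\ b1 \in C, b2 \in C, b1 != b2 & hd b1 b2 = d]) /\
  (forall b1 b2, b1 \in C -> b2 \in C -> b1 != b2 -> d <= hd b1 b2).

(* Rows of a generator matrix (entry j of a row = coordinate j+1).
   This is the extended cyclic (quadratic residue) Golay code with generator
   polynomial 1+x^2+x^4+x^5+x^6+x^10+x^11 (parity bit appended), with
   coordinates permuted so that (1^8,0^16) is a codeword.  (Checked by
   computer: weight enumerator 1 + 759 z^8 + 2576 z^12 + 759 z^16 + z^24,
   so this is a [24,12,8] binary code, i.e. an extended Golay code.) *)
Definition golay_rows : seq (seq nat) := [::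
  [:: 1; 0; 0; 0; 0; 0; 0; 1; 1; 0; 1; 1; 1; 0; 0; 0; 1; 1; 0; 0; 0; 0; 0; 0];
  [:: 0; 1; 0; 0; 0; 0; 0; 1; 0; 1; 0; 1; 1; 1; 0; 0; 0; 1; 1; 0; 0; 0; 0; 0];
  [:: 0; 0; 1; 0; 0; 0; 0; 1; 1; 0; 1; 0; 1; 1; 1; 0; 0; 0; 1; 0; 0; 0; 0; 0];
  [:: 0; 0; 1; 0; 0; 0; 0; 1; 0; 1; 0; 1; 0; 1; 1; 1; 0; 0; 0; 1; 0; 0; 0; 0];
  [:: 0; 0; 0; 1; 0; 0; 0; 1; 0; 0; 1; 0; 1; 0; 1; 1; 1; 0; 0; 1; 0; 0; 0; 0];
  [:: 0; 0; 0; 1; 0; 0; 0; 1; 0; 0; 0; 1; 0; 1; 0; 1; 1; 1; 0; 0; 1; 0; 0; 0];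
  [:: 0; 0; 0; 0; 1; 0; 0; 1; 0; 0; 0; 0; 1; 0; 1; 0; 1; 1; 1; 0; 1; 0; 0; 0];
  [:: 0; 0; 1; 0; 1; 1; 0; 1; 0; 0; 0; 0; 0; 1; 0; 1; 0; 1; 1; 0; 0; 0; 0; 0];
  [:: 0; 0; 1; 0; 0; 1; 1; 1; 0; 0; 0; 0; 0; 0; 1; 0; 1; 0; 1; 1; 0; 0; 0; 0];
  [:: 0; 0; 1; 1; 0; 0; 1; 1; 0; 0; 0; 0; 0; 0; 0; 1; 0; 1; 0; 1; 0; 1; 0; 0];
  [:: 0; 0; 0; 1; 0; 0; 0; 1; 0; 0; 0; 0; 0; 0; 0; 0; 1; 0; 1; 1; 1; 1; 1; 0];
  [:: 0; 0; 1; 1; 1; 0; 0; 1; 0; 0; 0; 0; 0; 0; 0; 0; 0; 1; 0; 0; 1; 0; 1; 1]].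

Definition golay_gen (i : 'I_12) (j : 'I_24) : bool :=
  nth 0 (nth [::] golay_rows i) j == 1.

Definition golay_encode (u : word 12) : word 24 :=
  [ffun j => \big[xorb/false]_(i < 12) (u i && golay_gen i j)].

Definition golay : {set word 24} := [set golay_encode u | u in [set: word 12]].

Definition Jstar : {set 'I_24} := [set j : 'I_24 | j < 8].

Definition supp m (a : word m) : {set 'I_m} := [set i | a i].

(* B = D^0 u D^1 u ... u D^7 : supp(a) /\ J* is empty or {i,8} with 1<=i<=7,
   i.e. ordinals {i-1, 7} *)
Definition NR_B : {set word 24} :=
  [set a in golay | (supp a :&: Jstar == set0) ||
     [exists i : 'I_7,
        supp a :&: Jstar == [set (inord i : 'I_24); (inord 7 : 'I_24)]]].

Definition restrJ (a : word 24) : word 16 := [ffun j : 'I_16 => a (inord (j + 8))].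

Definition NR : {set word 16} := [set restrJ a | a in NR_B].

Definition puncture (c : word 16) : word 15 := [ffun j : 'I_15 => c (inord j.+1)].

Definition PN : {set word 15} := [set puncture c | c in NR].

(* Main.v *)
Require Import Defs.
From mathcomp Require Import all_boot all_order all_fingroup.
From mathcomp Require Import zify.

Set Implicit Arguments.
Unset Strict Implicit.
Unset Printing Implicit Defensive.

(* A local double count in the Hamming graph turns complete regularity into linear equations between
   the numbers of codewords at given distances from the vertices of each C_i. Together with the
   divisibility conditions they force, for (m, delta) = (16, 6), that every vertex at distance 3 from
   C is at distance 3 from exactly 5 codewords, that rho = 4 and that |C| = 256; for (15, 5) the
   parity extension of C has the same property.

   Conversely, let C have length 16, minimum distance 6 and this property. Given a codeword and three
   coordinates, move them to 0 and to {0, 1, 2} and add codewords one at a time: at a vertex at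
   distance 3 from a known codeword the five nearest codewords differ from the vertex in five disjoint
   triples, so for any two coordinates p, q one of them differs from it at p or at q. Up to
   coordinate permutations fixing 0, 1, 2 there is always exactly one way to add such a codeword, and
   the procedure ends with NR. Since the codeword and the three coordinates were arbitrary, the same
   argument shows that the automorphisms of C act transitively on C_0, ..., C_3, and a vertex of C_3
   has exactly one neighbour in C_4. *)

(** * Distance counts in the Hamming graph *)

Section Distance.
Variable m : nat.
Implicit Types (u v w c : word m) (i : 'I_m) (C : {set word m}).

Lemma hd_sum u v : hd u v = \sum_i (u i != v i).
Proof. by rewrite /hd -sum1dep_card big_mkcond; apply: eq_bigr => i _; case: eqP. Qed.

Lemma hdC u v : hd u v = hd v u.
Proof. by rewrite !hd_sum; apply: eq_bigr => i _; rewrite eq_sym. Qed.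

Lemma hd_triangle u v w : hd u w <= hd u v + hd v w.
Proof.
rewrite !hd_sum -big_split; apply: leq_sum => i _ /=.
by case: (u i); case: (v i); case: (w i).
Qed.

Lemma hdvv v : hd v v = 0.
Proof. by rewrite hd_sum big1 // => i _; rewrite eqxx. Qed.

Lemma hd_eq0 u v : (hd u v == 0) = (u == v).
Proof.
apply/idP/eqP => [|->]; last by rewrite hdvv.
rewrite hd_sum sum_nat_eq0 => /forallP h; apply/ffunP => i.
by have := h i; case: (u i); case: (v i).
Qed.

Lemma hd_max u v : hd u v <= m.
Proof. by rewrite -[X in _ <= X]card_ord; apply: max_card. Qed.

Definition flip v i : word m := [ffun j => v j (+) (j == i)].

Lemma flipK v i : flip (flip v i) i = v.
Proof. by apply/ffunP => j; rewrite !ffunE -addbA addbb addbF. Qed.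

Lemma hd_flip v i c : hd (flip v i) c + (v i != c i) = hd v c + (v i == c i).
Proof.
rewrite !hd_sum (bigD1 i) //= [X in _ = X + _](bigD1 i) //= ffunE eqxx addbT.
rewrite (eq_bigr (fun j => (v j != c j) : nat)) => [|j /negPf h].
  by case: (v i); case: (c i) => /=; lia.
by rewrite ffunE h addbF.
Qed.

Lemma hd_adjacent u v : hd u v = 1 -> exists i, v = flip u i.
Proof.
move/eqP/cards1P => [i /setP hi]; exists i; apply/ffunP => j.
by have := hi j; rewrite !inE ffunE => <-; case: (u j); case: (v j).
Qed.

Definition ncw C k v := #|sphere k v :&: C|.

Lemma ncw_sum C k v : ncw C k v = \sum_(c in C) (hd v c == k).
Proof.
rewrite /ncw -sum1_card big_mkcond [RHS]big_mkcond; apply: eq_bigr => c _.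
by rewrite !inE andbC; case: (c \in C); case: eqP.
Qed.

(** A flip moves [v] towards [c] at the [hd v c] coordinates where they differ and away from it at
    the others. *)
Lemma card_flip_hd v c k :
  \sum_i (hd (flip v i) c == k.+1) = k.+2 * (hd v c == k.+2) + (m - k) * (hd v c == k).
Proof.
rewrite (eq_bigr (fun i => (hd v c == k.+2) * (v i != c i) + (hd v c == k) * (v i == c i))); last first.
  move=> i _; have := hd_flip v i c.
  by case: (v i == c i); case: eqP => a; case: eqP => b; case: eqP => d /=; lia.
rewrite big_split -!big_distrr /= -hd_sum.
have e : hd v c + \sum_i (v i == c i) = m.
  rewrite hd_sum -big_split /= (eq_bigr (fun=> 1)) ?sum1_card ?card_ord // => i _.
  by case: eqP.
set s := \sum_i _ in e *; case: eqP => a; case: eqP => b /=; rewrite ?muln0 ?muln1 ?mul0n ?mul1n; lia.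
Qed.

(** Double count of the pairs of a neighbour of [v] and a codeword at distance k + 1 from it. All
    later equations come from this and from the distance 0 case below. *)
Lemma sum_ncw_flip C k v :
  \sum_i ncw C k.+1 (flip v i) = k.+2 * ncw C k.+2 v + (m - k) * ncw C k v.
Proof.
under eq_bigr do rewrite ncw_sum.
rewrite exchange_big /= !ncw_sum !big_distrr -big_split /=.
by apply: eq_bigr => c _; rewrite card_flip_hd.
Qed.

Lemma sum_ncw0_flip C v : \sum_i ncw C 0 (flip v i) = ncw C 1 v.
Proof.
under eq_bigr do rewrite ncw_sum.
rewrite exchange_big /= ncw_sum; apply: eq_bigr => c _.
rewrite -(mul1n (_ == _)).
rewrite (eq_bigr (fun i => (hd v c == 1) * (v i != c i))); last first.
  move=> i _; have := hd_flip v i c; case: eqP => h; case: eqP => h1; case: (v i == c i); lia.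
by rewrite -big_distrr /= -hd_sum; case: eqP => [->|].
Qed.

Lemma dcode_le C v c : c \in C -> dcode C v <= hd v c.
Proof.
move=> cC; have : c \in [seq b <- index_enum (word m) | b \in C].
  by rewrite mem_filter cC mem_index_enum.
rewrite /dcode -big_filter; elim: [seq _ <- _ | _] => //= b s IH.
rewrite inE big_cons geq_min => /predU1P[->|/IH ->]; first by rewrite leqnn.
by rewrite orbT.
Qed.

(* The default value [m] of [dcode] bounds every distance, so it does no harm when [C] is nonempty. *)
Lemma dcode_attained C v : C != set0 -> exists2 c, c \in C & hd v c = dcode C v.
Proof.
case/set0Pn => c0 c0C.
have h : dcode C v = m \/ exists2 c, c \in C & hd v c = dcode C v.
  rewrite /dcode; elim/big_rec: _ => [|c d cC h]; first by left.
  case: leqP => _ //.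
  by right; exists c.
case: h => // h; exists c0 => //; apply/eqP; rewrite eqn_leq dcode_le // andbT.
by rewrite h hd_max.
Qed.

Lemma dcode_flip C v i : C != set0 -> dcode C (flip v i) <= (dcode C v).+1.
Proof.
move=> C0; have [c cC <-] := dcode_attained v C0.
by apply: leq_trans (dcode_le _ cC) _; have := hd_flip v i c; case: (_ == _); lia.
Qed.

Lemma ncw_gt0 C k v : (0 < ncw C k v) <-> exists2 c, c \in C & hd v c = k.
Proof.
rewrite /ncw card_gt0; split => [/set0Pn [c]|[c cC h]].
  by rewrite !inE => /andP[/eqP h cC]; exists c.
by apply/set0Pn; exists c; rewrite !inE cC h eqxx.
Qed.

Lemma ncw_lt C k v : k < dcode C v -> ncw C k v = 0.
Proof.
move=> h; apply/eqP; rewrite -leqn0 leqNgt; apply/negP => /ncw_gt0 [c cC e].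
by have := dcode_le v cC; lia.
Qed.

End Distance.

(** * Edges between the levels of the distance partition *)

Section Neighbours.
Variables (m : nat) (C : {set word m}).
Hypothesis C0 : C != set0.
Implicit Types v : word m.

(** The intersection numbers c, a and b of the distance partition, taken at a single vertex. The
    successor in [ndown] is placed so that nothing truncates at level 0. *)
Definition ndown v := \sum_i (dcode C v == (dcode C (flip v i)).+1).
Definition nlevel v := \sum_i (dcode C (flip v i) == dcode C v).
Definition nup v := \sum_i (dcode C (flip v i) == (dcode C v).+1).

Lemma dcode_flipP v i : [|| dcode C v == (dcode C (flip v i)).+1, dcode C (flip v i) == dcode C v
  | dcode C (flip v i) == (dcode C v).+1].
Proof.
have h1 := dcode_flip v i C0; have := dcode_flip (flip v i) i C0.
rewrite flipK; lia.
Qed.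

(** A flip changes the distance to the code by at most one. The predecessor is harmless at level 0,
    where [ndown] vanishes. *)
Lemma sum_level v (f : nat -> nat) :
  \sum_i f (dcode C (flip v i)) =
  ndown v * f (dcode C v).-1 + nlevel v * f (dcode C v) + nup v * f (dcode C v).+1.
Proof.
rewrite !big_distrl -!big_split; apply: eq_bigr => i _ /=.
have n1 k : (k == k.+1) = false by lia.
have n2 k : (k == k.+2) = false by lia.
have n3 k : (k.+1 == k) = false by lia.
by move: (dcode_flipP v i) => /or3P[] /eqP ->; rewrite !eqxx ?n1 ?n2 ?n3 /= ?mul1n ?mul0n ?addn0.
Qed.

Lemma sum_levels v : ndown v + nlevel v + nup v = m.
Proof.
by have := sum_level v (fun=> 1); rewrite sum_nat_const card_ord !muln1 => ->.
Qed.

Lemma ndown0 v : dcode C v = 0 -> ndown v = 0.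
Proof. by move=> h; rewrite /ndown h big1. Qed.

Lemma nup_neighbour v : 0 < nup v -> exists i, dcode C (flip v i) = (dcode C v).+1.
Proof.
move=> h; suff /existsP[i /eqP e] : [exists i, dcode C (flip v i) == (dcode C v).+1] by exists i.
apply: contraTT h => /existsPn h; rewrite -leqNgt leqn0 /nup big1 // => i _.
by rewrite (negPf (h i)).
Qed.

Lemma down_neighbour v : 0 < dcode C v -> exists i, dcode C v = (dcode C (flip v i)).+1.
Proof.
move=> h; have [c cC e] := dcode_attained v C0.
have /existsP[i ni] : [exists i, v i != c i].
  apply: contraTT h => /existsPn h; rewrite -e -leqNgt leqn0 hd_eq0.
  by apply/eqP/ffunP => i; apply/eqP; have := h i; rewrite negbK.
exists i; have := hd_flip v i c; rewrite ni (negPf ni) e.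
have := dcode_le (flip v i) cC; have := dcode_flip (flip v i) i C0.
by rewrite flipK /=; lia.
Qed.

(** From a vertex beyond level r one can descend level by level, which would end with an upward edge
    out of level r. *)
Lemma dcode_bound r : (forall v, dcode C v = r -> nup v = 0) -> forall v, dcode C v <= r.
Proof.
move=> hr; suff h n v : dcode C v <> r.+1 + n.
  move=> v; rewrite leqNgt; apply/negP => lt; apply: (h (dcode C v - r.+1) v); lia.
elim: n v => [|n IH] v e; have [|i ei] := @down_neighbour v; try lia.
  have hw : dcode C (flip v i) = r by lia.
  have := hr _ hw; rewrite /nup => /eqP; rewrite sum_nat_eq0 => /forallP /(_ i).
  by rewrite flipK -ei eqxx.
by apply: (IH (flip v i)); lia.
Qed.

Lemma card_levels r : (forall v, dcode C v <= r) -> \sum_(i < r.+1) #|dpart C i| = 2 ^ m.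
Proof.
move=> hr.
have -> : 2 ^ m = #|{: word m}| by rewrite card_ffun card_bool card_ord.
rewrite -sum1_card (partition_big (fun v => inord (dcode C v) : 'I_r.+1) predT) //=.
apply: eq_bigr => i _; rewrite -sum1_card; apply: eq_bigl => v.
by rewrite inE -val_eqE /= inordK // ltnS.
Qed.

Lemma dpart0 : dpart C 0 = C.
Proof.
apply/setP => v; rewrite inE; apply/eqP/idP => [h|vC].
  by have [c cC] := dcode_attained v C0; rewrite h => /eqP; rewrite hd_eq0 => /eqP ->.
by have := dcode_le v vC; rewrite hdvv leqn0 => /eqP.
Qed.

(** Double count of the edges between two consecutive levels, one coordinate at a time: flipping it
    exchanges the two ends. *)
Lemma card_level_edges i a b :
  (forall v, dcode C v = i -> nup v = a) -> (forall v, dcode C v = i.+1 -> ndown v = b) ->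
  #|dpart C i| * a = #|dpart C i.+1| * b.
Proof.
move=> ha hb.
rewrite -!sum_nat_const (eq_bigr nup) => [|v]; last by rewrite inE => /eqP/ha.
rewrite [RHS](eq_bigr ndown) => [|v]; last by rewrite inE => /eqP/hb.
rewrite exchange_big [RHS]exchange_big /=; apply: eq_bigr => j _.
have flip_inj : injective (fun v : word m => flip v j).
  by apply: (@can_inj _ _ _ (fun v => flip v j)) => v; rewrite flipK.
rewrite [RHS](reindex_inj flip_inj) /=.
rewrite [LHS]big_mkcond [RHS]big_mkcond; apply: eq_bigr => v _.
rewrite !inE flipK; move: (dcode C v) (dcode C (flip v j)) => x y.
by case: (x =P i) => h1; case: (y =P i.+1) => h2 //; lia.
Qed.

End Neighbours.

(** * Outer distribution of a completely regular code *)

Section MinDistance.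
Variables (m d : nat) (C : {set word m}).
Hypothesis dC : forall c c', c \in C -> c' \in C -> c != c' -> d <= hd c c'.
Implicit Types (v c : word m).

Lemma codeword_unique v c c' : c \in C -> c' \in C -> hd v c + hd v c' < d -> c' = c.
Proof.
move=> cC c'C h; apply/eqP/negPn/negP => n; have := dC c'C cC n.
by have := hd_triangle c' v c; rewrite (hdC c' v); lia.
Qed.

(** At exactly half of [d] another codeword may be equally near, but none is nearer. *)
Lemma dcode_near v c : c \in C -> (hd v c).*2 <= d -> dcode C v = hd v c.
Proof.
move=> cC h; have C0 : C != set0 by apply/set0Pn; exists c.
have [c' c'C e] := dcode_attained v C0; have := dcode_le v cC; rewrite -e => le.
have [->//|n] := eqVneq c' c.
by have := dC c'C cC n; have := hd_triangle c' v c; rewrite (hdC c' v); lia.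
Qed.

Lemma ncw_near v c : c \in C -> (hd v c).*2 < d -> ncw C (hd v c) v = 1.
Proof.
move=> cC h; apply/eqP/cards1P; exists c; apply/setP => c'; rewrite !inE.
apply/idP/eqP => [/andP[/eqP e c'C]|->]; last by rewrite eqxx.
by apply: (@codeword_unique v) => //; lia.
Qed.

Lemma ncw_gap v c k : c \in C -> hd v c < k -> k + hd v c < d -> ncw C k v = 0.
Proof.
move=> cC h1 h2; apply/eqP; rewrite -leqn0 leqNgt; apply/negP => /ncw_gt0 [c' c'C e].
have e' : c' = c by apply: (@codeword_unique v) => //; lia.
by move: h1; rewrite -e e' ltnn.
Qed.

Lemma at_distance c i : i <= m -> exists v, hd v c = i.
Proof.
elim: i => [_|i IH im]; first by exists c; rewrite hdvv.
have [v e] := IH (ltnW im).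
have /existsP[j /eqP hj] : [exists j, v j == c j].
  apply: contraT => /existsPn h; move: im; rewrite -e hd_sum.
  rewrite (eq_bigr (fun=> 1)) ?sum1_card ?card_ord ?ltnn // => j _.
  by have := h j; case: eqP.
by exists (flip v j); have := hd_flip v j c; rewrite hj eqxx; lia.
Qed.

(** Flipping a coordinate where [v] differs from a nearest codeword leads one level down. Two
    nearest codewords give distinct sets of such coordinates of equal size, so their union is larger
    than either. *)
Lemma ndown_gt v : C != set0 -> 1 < ncw C (dcode C v) v -> dcode C v < ndown C v.
Proof.
move=> C0; set k := dcode C v => n1.
have [c] : exists c, c \in sphere k v :&: C by apply/set0Pn; rewrite -card_gt0; apply: ltnW.
rewrite !inE => /andP[/eqP hc cC].
have [c'] : exists c', c' \in (sphere k v :&: C) :\ c.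
  have cS : c \in sphere k v :&: C by rewrite !inE hc eqxx.
  by apply/set0Pn; rewrite -card_gt0; move: n1; rewrite /ncw (cardsD1 c (_ :&: _)) cS.
rewrite !inE => /and3P[nc /eqP hc' c'C].
pose D c := [set i | v i != c i].
have sD a : a \in C -> hd v a = k -> D a \subset [set i | dcode C v == (dcode C (flip v i)).+1].
  move=> aC ha; apply/subsetP => i; rewrite !inE => ni.
  have := hd_flip v i a; rewrite ni (negPf ni) ha => e.
  have := dcode_le (flip v i) aC; have := dcode_flip (flip v i) i C0.
  by rewrite flipK -/k => h1 h2; move: e => /= e; apply/eqP; lia.
have -> : ndown C v = #|[set i | dcode C v == (dcode C (flip v i)).+1]|.
  by rewrite /ndown -sum1dep_card [RHS]big_mkcond; apply: eq_bigr => i _; case: eqP.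
rewrite -hc; apply: proper_card; rewrite properE (sD _ cC hc) /=; apply/negP => s.
have e : D c' = D c.
  apply/eqP; rewrite eqEcard (subset_trans (sD _ c'C hc') s) /=.
  by move: hc hc'; rewrite /hd => -> ->.
case/negP: nc; apply/eqP/ffunP => i; move/setP: e => /(_ i); rewrite !inE.
by case: (v i); case: (c i); case: (c' i).
Qed.

End MinDistance.

Section CompletelyRegular.
Variables (m : nat) (C : {set word m}).
Hypotheses (C0 : C != set0) (crC : completely_regular C).
Implicit Types v : word m.

(* The entry B_{i,k} of Delsarte's outer distribution matrix, 0 if C_i is empty. *)
Definition outer i k := if [pick v | dcode C v == i] is Some v then ncw C k v else 0.

Lemma ncw_outer v k : ncw C k v = outer (dcode C v) k.
Proof.
rewrite /outer; case: pickP => [w /eqP e|/(_ v)]; last by rewrite eqxx.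
by apply: (crC (i := dcode C v)); rewrite inE ?e.
Qed.

(** The double count with the neighbours grouped by level: by complete regularity each term depends
    on the level alone. *)
Lemma outer_balance v i k : dcode C v = i ->
  ndown C v * outer i.-1 k.+1 + nlevel C v * outer i k.+1 + nup C v * outer i.+1 k.+1 =
  k.+2 * outer i k.+2 + (m - k) * outer i k.
Proof.
move=> e; have := sum_ncw_flip C k v; rewrite !ncw_outer e => <-.
by rewrite -e -(sum_level C0 v (fun i => outer i k.+1)); apply: eq_bigr => j _; rewrite ncw_outer.
Qed.

Lemma outer_balance0 v i : dcode C v = i ->
  ndown C v * outer i.-1 0 + nlevel C v * outer i 0 + nup C v * outer i.+1 0 = outer i 1.
Proof.
move=> e; have := sum_ncw0_flip C v; rewrite !ncw_outer e => <-.
by rewrite -e -(sum_level C0 v (fun i => outer i 0)); apply: eq_bigr => j _; rewrite ncw_outer.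
Qed.

Lemma outer_lt i k : k < i -> outer i k = 0.
Proof. by move=> h; rewrite /outer; case: pickP => // v /eqP e; rewrite ncw_lt ?e. Qed.

Variable d : nat.
Hypotheses (dm : d <= m) (dC : min_dist C d).

Lemma level_inhabited i : i.*2 <= d -> exists v, dcode C v = i.
Proof.
move=> hi; have [c cC] := set0Pn _ C0; have [|v hv] := at_distance c (i := i); first lia.
by exists v; rewrite -hv; apply: (dcode_near dC.2 cC); rewrite hv.
Qed.

Lemma level_codeword i v : dcode C v = i -> exists2 c, c \in C & hd v c = i.
Proof. by move=> <-; apply: dcode_attained. Qed.

Lemma outer_diag i : i.*2 < d -> outer i i = 1.
Proof.
move=> hi; have [v e] := level_inhabited (ltnW hi).
have [c cC hv] := level_codeword e.
by have := ncw_outer v i; rewrite e -{1}hv (ncw_near dC.2 cC) // hv.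
Qed.

Lemma outer_gap i k : i < k -> k + i < d -> outer i k = 0.
Proof.
move=> ik ki; have [|v e] := @level_inhabited i; first lia.
have [c cC hv] := level_codeword e.
by have := ncw_outer v k; rewrite e (ncw_gap dC.2 cC) // hv.
Qed.

Lemma outer_min_gt0 : 0 < outer 0 d.
Proof.
have [[c [c' [cC c'C _ h]]] _] := dC.
have := ncw_outer c d; have := dpart0 C0 => /setP /(_ c); rewrite inE cC => /eqP -> <-.
by apply/ncw_gt0; exists c'.
Qed.

(** In column i - 1 of the balance for row i only diagonal entries survive, and they equal 1. *)
Lemma ndown_small i v : i.*2 < d -> dcode C v = i -> ndown C v = i.
Proof.
case: i => [|[|i]] h e; first exact: ndown0.
  have := outer_balance0 e; rewrite /= !outer_diag ?outer_lt //; lia.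
have := @outer_balance _ _ i e.
by rewrite /= !outer_diag ?(@outer_lt _ i.+1) ?(@outer_lt i.+2) ?(@outer_lt i.+3) //; lia.
Qed.

(** Column i of the balance reduces to [nlevel] alone: the stronger bound on i makes [outer i i.+1]
    vanish. *)
Lemma level_small i v : i.*2.+1 < d -> dcode C v = i ->
  [/\ ndown C v = i, nlevel C v = 0 & nup C v = m - i].
Proof.
move=> h e; have hd := ndown_small (ltnW h) e; rewrite hd.
suff hl : nlevel C v = 0 by have := sum_levels C0 v; rewrite hd hl; split => //; lia.
case: i h e hd => [|i] h e hd.
  have := outer_balance0 e; rewrite hd /= (@outer_diag 0) ?(@outer_gap 0 1) ?(@outer_lt 1 0); lia.
have := @outer_balance _ _ i e.
rewrite /= (@outer_gap i i.+1) ?(@outer_gap i.+1 i.+2) ?(outer_diag (i := i.+1)); try lia.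
by rewrite ?(@outer_lt i.+1) ?(@outer_lt i.+2) //; lia.
Qed.

End CompletelyRegular.

Lemma min_dist_neq0 m d (C : {set word m}) : min_dist C d -> C != set0.
Proof. by case=> [[c [_ [cC _ _ _]]] _]; apply/set0Pn; exists c. Qed.

(** * Parameters for (16,6) and (15,5) *)

Section Length16.
Variable C : {set word 16}.
Hypotheses (crC : completely_regular C) (dC : min_dist C 6).
Let C0 := min_dist_neq0 dC.
Let d16 : 6 <= 16 := isT.
Local Notation B := (outer C).

(** Level 3 is half the minimum distance, so the number of nearest codewords is no longer forced to
    be 1; the equations of the lower rows and integrality determine it. *)
Lemma parameters16 :
  [/\ B 3 3 = 5, forall v, dcode C v = 3 -> ndown C v = 15,
      forall v, dcode C v = 3 -> nup C v = 1 & forall v, dcode C v = 4 -> ndown C v = 16].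
Proof.
have E i k v (e : dcode C v = i) := outer_balance C0 crC k e.
have S v := sum_levels C0 v; have Z i k (h : k < i) := outer_lt C h.
have gap := outer_gap C0 crC d16 dC; have small := level_small C0 crC d16 dC.
have [v0 e0] := level_inhabited C0 d16 dC (isT : 0.*2 <= 6).
have [v1 e1] := level_inhabited C0 d16 dC (isT : 1.*2 <= 6).
have [v2 e2] := level_inhabited C0 d16 dC (isT : 2.*2 <= 6).
have [v3 e3] := level_inhabited C0 d16 dC (isT : 3.*2 <= 6).
have B22 := outer_diag C0 crC d16 dC (isT : 2.*2 < 6).
have B06 := outer_min_gt0 C0 crC dC.
have [a0 b0 c0] := small 0 v0 isT e0; have [a1 b1 c1] := small 1 v1 isT e1.
have [a2 b2 c2] := small 2 v2 isT e2; rewrite /= in E.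
(* In [Fik] the row is i and the left side concerns column k + 1. *)
have F04 := E _ 4 _ e0; have F05 := E _ 5 _ e0; have F06 := E _ 6 _ e0.
have F13 := E _ 3 _ e1; have F14 := E _ 4 _ e1; have F15 := E _ 5 _ e1.
have F22 := E _ 2 _ e2; have F23 := E _ 3 _ e2; have F24 := E _ 4 _ e2.
rewrite a0 b0 c0 (gap 0 4) // (gap 0 5) // in F04 F05 F06.
rewrite a1 b1 c1 (gap 0 4) // (gap 0 5) // (gap 1 4) // (gap 1 3) // in F13 F14 F15.
rewrite a2 b2 c2 B22 (gap 2 3) // (gap 1 3) // (gap 1 4) // in F22 F23 F24.
have n3 v (e : dcode C v = 3) : ndown C v = 3 * B 3 3.
  have := E _ 1 _ e; rewrite /= B22 (Z 3 1) // (Z 3 2) // (Z 4 2) //; lia.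
have F2 v (e : dcode C v = 3) : nlevel C v * B 3 3 = 4 * B 3 4.
  by have := E _ 2 _ e; rewrite /= (gap 2 3) // (Z 4 3) // (Z 3 2) //; lia.
have G v (e : dcode C v = 4) : ndown C v * B 3 3 = 4 * B 4 4.
  by have := E _ 2 _ e; rewrite /= (Z 5 3) // (Z 4 3) // (Z 4 2) //=; lia.
have H3 := E _ 3 _ e3; have H2 := F2 v3 e3; have K3 := n3 v3 e3; have S3 := S v3.
have X4 : 0 < nup C v3 -> exists v, dcode C v = 4.
  by move/(nup_neighbour) => [i h]; exists (flip v3 i); rewrite h e3.
rewrite /= in F04 F05 F06 F13 F14 F15 F22 F23 F24 H3.
(* [B 3 3 - 1] is the index lambda of the 3-(16,6,lambda) design formed by the words of weight 6
   (with the origin in [C]); for lambda = 2 integrality leaves only solutions in which a vertex of C_4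
   has more than 16 neighbours in C_3. *)
have [B33|B33] : B 3 3 = 3 \/ B 3 3 = 5 by clear -F04 F13 F22 K3 S3 B06; lia.
  rewrite B33 in F22 H2 H3 K3.
  (* [F23] makes [B 3 4] a multiple of 5 and [H2] a multiple of 3, while [nlevel C v3 <= 7] bounds
     [4 * B 3 4] by 21. *)
  have [B34 [l3 u3]] : B 3 4 = 0 /\ nlevel C v3 = 0 /\ nup C v3 = 7.
    by clear -H2 K3 S3 F23; lia.
  have [|v4 e4] := X4; first by rewrite u3.
  have G4 := G _ e4; have S4 := S v4.
  rewrite B33 in G4; rewrite l3 u3 K3 in H3.
  by clear -F04 F05 F06 F13 F14 F15 F22 F23 F24 H3 G4 S4 B34; lia.
rewrite B33 in F22 H2 H3 K3.
(* [H2] makes [nlevel C v3] a multiple of 4, and only one neighbour is not below. *)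
have [B34 [l3 u3]] : B 3 4 = 0 /\ nlevel C v3 = 0 /\ nup C v3 = 1.
  by clear -H2 K3 S3; lia.
have d3 v (e : dcode C v = 3) : ndown C v = 15 by rewrite n3 // B33.
(* For [B 4 4 = 5] a vertex of C_4 has only 4 neighbours in C_3, although each of its nearest codewords
   provides 4 of them: all 5 codewords would coincide. *)
have B44 : B 4 4 = 20.
  have [|v4 e4] := X4; first by rewrite u3.
  have G4 := G _ e4; have S4 := S v4.
  rewrite B33 in G4; rewrite l3 u3 K3 in H3.
  have [//|B44] : B 4 4 = 20 \/ B 4 4 = 5.
    by clear -F04 F05 F06 F13 F14 F15 F22 F23 F24 H3 G4 S4 B34; lia.
  have := ndown_gt (v := v4) C0; rewrite (ncw_outer crC) e4 B44 => /(_ isT).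
  by clear -G4 B44; lia.
split=> // v e; last by have := G _ e; rewrite B33 B44; lia.
by have := d3 _ e; have := F2 _ e; have := S v; rewrite B33 B34; lia.
Qed.

Lemma covering16 v : dcode C v <= 4.
Proof.
apply: (dcode_bound C0) => {}v e; have := sum_levels C0 v.
by have [_ _ _ h4] := parameters16; rewrite h4 //; lia.
Qed.

(** The edge counts make the levels 1, 16, 120, 112 and 7 times as large as [C], in total 256
    times. *)
Lemma card16 : #|C| = 2 ^ 8.
Proof.
have [_ d3 u3 d4] := parameters16.
have up i v (h : i.*2.+1 < 6) (e : dcode C v = i) : nup C v = 16 - i.
  by have [] := level_small C0 crC d16 dC h e.
have down i v (h : i.*2 < 6) (e : dcode C v = i) := ndown_small C0 crC d16 dC h e.
have := card_level_edges C0 (fun v => up 0 v isT) (fun v => down 1 v isT).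
have := card_level_edges C0 (fun v => up 1 v isT) (fun v => down 2 v isT).
have := card_level_edges C0 (fun v => up 2 v isT) d3.
have := card_level_edges C0 u3 d4.
have := card_levels covering16; rewrite !big_ord_recr big_ord0 /= !dpart0 //; lia.
Qed.

End Length16.

Section Length15.
Variable C : {set word 15}.
Hypotheses (crC : completely_regular C) (dC : min_dist C 5).
Let C0 := min_dist_neq0 dC.
Let d15 : 5 <= 15 := isT.
Local Notation B := (outer C).

(** Here [nlevel] is open already at level 2, since 2 * 2 + 1 is the minimum distance. *)
Lemma parameters15 :
  [/\ B 2 2 = 1, B 2 3 = 4, B 3 3 = 5, forall v, dcode C v = 2 -> nup C v = 1 &
      forall v, dcode C v = 3 -> ndown C v = 15].
Proof.
have E i k v (e : dcode C v = i) := outer_balance C0 crC k e.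
have S v := sum_levels C0 v; have Z i k (h : k < i) := outer_lt C h.
have gap := outer_gap C0 crC d15 dC; have small := level_small C0 crC d15 dC.
have [v0 e0] := level_inhabited C0 d15 dC (isT : 0.*2 <= 5).
have [v1 e1] := level_inhabited C0 d15 dC (isT : 1.*2 <= 5).
have [v2 e2] := level_inhabited C0 d15 dC (isT : 2.*2 <= 5).
have B22 := outer_diag C0 crC d15 dC (isT : 2.*2 < 5).
have B05 := outer_min_gt0 C0 crC dC.
have [a0 b0 c0] := small 0 v0 isT e0; have [a1 b1 c1] := small 1 v1 isT e1.
have n2 v (e : dcode C v = 2) := ndown_small C0 crC d15 dC (isT : 2.*2 < 5) e.
have S2 := S v2; have D2 := n2 v2 e2.
rewrite /= in E.
have F03 := E _ 3 _ e0; have F04 := E _ 4 _ e0.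
have F12 := E _ 2 _ e1; have F13 := E _ 3 _ e1.
have F22 := E _ 2 _ e2; have F23 := E _ 3 _ e2.
have l2 v (e : dcode C v = 2) : nlevel C v = 3 * B 2 3.
  have := E _ 1 _ e; rewrite /= B22 (gap 1 2) // (Z 3 2) // (Z 2 1) //; lia.
have L2 := l2 v2 e2.
rewrite a0 b0 c0 (gap 0 4) // (gap 0 3) // in F03 F04.
rewrite a1 b1 c1 (gap 0 3) // (gap 0 4) // (gap 1 2) // (gap 1 3) // in F12 F13.
rewrite D2 L2 B22 (gap 1 3) // in F22 F23.
have d3 v (e : dcode C v = 3) : ndown C v = 3 * B 3 3.
  have := E _ 1 _ e; rewrite /= B22 (Z 3 1) // (Z 3 2) // (Z 4 2) //; lia.
have X3 : 0 < nup C v2 -> exists v, dcode C v = 3.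
  by move/(nup_neighbour) => [i h]; exists (flip v2 i); rewrite h e2.
rewrite /= in F03 F04 F12 F13 F22 F23.
(* [F12] makes [B 2 3] even, [F03] and [B05] make it positive, and 2 + 3 * [B 2 3] is at most 15. *)
have [B23|B23] : B 2 3 = 2 \/ B 2 3 = 4 by clear -F03 F12 B05 S2 D2 L2; lia.
  rewrite B23 in L2 F12 F22 F23.
  have u2 : nup C v2 = 7 by clear -L2 S2 D2; lia.
  have [|v3 e3] := X3; first by rewrite u2.
  have H2 := E _ 2 _ e3; have D3 := d3 v3 e3; have S3 := S v3.
  rewrite u2 in F22 F23; rewrite D3 (Z 4 3) // (Z 3 2) //= B23 in H2.
  (* [F13] makes [B 2 4] a multiple of 5, so [F22] determines [B 3 3] modulo 20. *)
  have B33 : B 3 3 = 3 by clear -F12 F13 F22 D3 S3; lia.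
  rewrite B33 in H2 D3 F22.
  (* [H2] and [F23] make [B 3 4] a multiple of 3 and of 5, but [4 * B 3 4] lies between 18 and
     36. *)
  by clear -F12 F13 F22 F23 H2 D3 S3; lia.
rewrite B23 in L2 F12 F22 F23.
have u2 : nup C v2 = 1 by clear -L2 S2 D2; lia.
have [|v3 e3] := X3; first by rewrite u2.
have D3 := d3 v3 e3; have S3 := S v3.
rewrite u2 in F22.
have B33 : B 3 3 = 5 by clear -F12 F13 F22 D3 S3; lia.
split=> // v e; last by rewrite d3 // B33.
by have := n2 _ e; have := l2 _ e; have := S v; rewrite B23; lia.
Qed.

Lemma covering15 v : dcode C v <= 3.
Proof.
apply: (dcode_bound C0) => {}v e; have := sum_levels C0 v.
by have [_ _ _ _ h3] := parameters15; rewrite h3 //; lia.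
Qed.

(** The levels are 1, 15, 105 and 7 times as large as [C], in total 128 times. *)
Lemma card15 : #|C| = 2 ^ 8.
Proof.
have [_ _ _ u2 d3] := parameters15.
have up i v (h : i.*2.+1 < 5) (e : dcode C v = i) : nup C v = 15 - i.
  by have [] := level_small C0 crC d15 dC h e.
have down i v (h : i.*2 < 5) (e : dcode C v = i) := ndown_small C0 crC d15 dC h e.
have := card_level_edges C0 (fun v => up 0 v isT) (fun v => down 1 v isT).
have := card_level_edges C0 (fun v => up 1 v isT) (fun v => down 2 v isT).
have := card_level_edges C0 u2 d3.
have := card_levels covering15; rewrite !big_ord_recr big_ord0 /= !dpart0 //; lia.
Qed.

End Length15.

(** * Reconstruction of the code from one codeword and three coordinates *)

(* If the origin is in [C], the second clause says that every triple lies in exactly 4 words of weight 6. *)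
Definition locally_3design (C : {set word 16}) : Prop :=
  (forall c c', c \in C -> c' \in C -> c != c' -> 6 <= hd c c') /\
  (forall w c, c \in C -> hd w c = 3 -> ncw C 3 w = 5).

(** The five disjoint triples cover 15 of the 16 coordinates, so [p] and [q] cannot both be
    missed. *)
Lemma codeword_through C w c p q : locally_3design C -> c \in C -> hd w c = 3 -> p != q ->
  exists2 c', c' \in C & hd w c' = 3 /\ (w p != c' p) || (w q != c' q).
Proof.
move=> [dC hC] cC hwc npq; have h5 := hC _ _ cC hwc.
suff /existsP[c' /andP[]] : [exists c', (c' \in sphere 3 w :&: C) && ((w p != c' p) || (w q != c' q))].
  by rewrite !inE => /andP[/eqP h1 h2] h3; exists c'.
apply: contraT => /existsPn none.
(* Two codewords that both differ from [w] at i would be within 2 of [flip w i], hence at distance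
   at most 4. *)
have le1 i : \sum_(c' in sphere 3 w :&: C) (w i != c' i) <= 1.
  rewrite -big_mkcondr sum1dep_card; apply/card_le1P => a; rewrite !inE.
  move=> /andP[/andP[/eqP ha aC] na] b; rewrite !inE; apply/idP/eqP => [|->]; last by rewrite ha eqxx aC.
  move=> /andP[/andP[/eqP hb bC] nb]; apply/eqP/negPn/negP => nab.
  have := dC _ _ bC aC nab; have := hd_triangle b (flip w i) a; rewrite (hdC b (flip w i)).
  have := hd_flip w i a; have := hd_flip w i b.
  by rewrite (negPf na) (negPf nb) ha hb /=; lia.
have : \sum_i \sum_(c' in sphere 3 w :&: C) (w i != c' i) = 15.
  rewrite exchange_big /= (eq_bigr (fun=> 3)) => [|c']; first by rewrite sum_nat_const -/(ncw C 3 w) h5.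
  by rewrite !inE => /andP[/eqP h _]; rewrite -hd_sum.
have z i : (i == p) || (i == q) -> \sum_(c' in sphere 3 w :&: C) (w i != c' i) = 0.
  move=> hi; apply: big1 => c' c'S; have := none c'; rewrite c'S /= negb_or.
  by case/andP => np nq; case/orP: hi => /eqP ->; apply/eqP; rewrite eqb0.
rewrite (bigD1 p) //= (bigD1 q) 1?eq_sym //= !z ?eqxx ?orbT // !add0n => e.
suff : \sum_(i | (i != p) && (i != q)) \sum_(c' in sphere 3 w :&: C) (w i != c' i) <= 14 by rewrite e.
apply: (@leq_trans (\sum_(i | (i != p) && (i != q)) 1)).
  by apply: leq_sum => i _; apply: le1.
rewrite sum1dep_card.
rewrite (_ : [set _ | _] = ~: [set p; q]); last by apply/setP => i; rewrite !inE negb_or.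
by have := cardsC [set p; q]; rewrite cards2 npq card_ord; lia.
Qed.

(** * Isometries of the Hamming graph *)

Section Isometry.
Variables (f g : word 16 -> word 16).
Hypotheses (fK : cancel f g) (gK : cancel g f) (hdf : forall u v, hd (f u) (f v) = hd u v).

Lemma ncw_imset (C : {set word 16}) k w : ncw (f @: C) k (f w) = ncw C k w.
Proof.
rewrite /ncw -(card_imset (sphere k w :&: C) (can_inj fK)); congr #|pred_of_set _|.
apply/setP => v; rewrite -(gK v) (mem_imset _ _ (can_inj fK)) !inE (mem_imset _ _ (can_inj fK)).
by rewrite hdf.
Qed.

Lemma locally_3design_imset (C : {set word 16}) : locally_3design C -> locally_3design (f @: C).
Proof.
move=> [dC hC]; split=> [_ _ /imsetP[c cC ->] /imsetP[c' c'C ->]|w _ /imsetP[c cC ->]].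
  by rewrite (inj_eq (can_inj fK)) hdf; apply: dC.
by rewrite -(gK w) hdf ncw_imset; apply: hC.
Qed.

End Isometry.

Section Wperm.
Variable m : nat.
Implicit Types (s t : {perm 'I_m}) (u v a : word m).

Lemma hd_wperm s u v : hd (wperm s u) (wperm s v) = hd u v.
Proof.
rewrite !hd_sum [RHS](reindex_inj (@perm_inj _ s)) /=.
by apply: eq_bigr => i _; rewrite !ffunE.
Qed.

(** Permutation products apply the left factor first, and [wperm] precomposes. *)
Lemma wpermM s t v : wperm s (wperm t v) = wperm (s * t)%g v.
Proof. by apply/ffunP => i; rewrite !ffunE permM. Qed.

Lemma wperm1 v : wperm 1 v = v.
Proof. by apply/ffunP => i; rewrite !ffunE perm1. Qed.

Lemma wpermK s : cancel (@wperm m s) (wperm s^-1).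
Proof. by move=> v; rewrite wpermM mulVg wperm1. Qed.

Lemma wpermKV s : cancel (@wperm m s^-1) (wperm s).
Proof. by move=> v; rewrite wpermM mulgV wperm1. Qed.

Lemma waddK a : involutive (@wadd m ^~ a).
Proof. by move=> v; apply/ffunP => i; rewrite !ffunE; case: (v i); case: (a i). Qed.

Lemma hd_wadd a u v : hd (wadd u a) (wadd v a) = hd u v.
Proof.
rewrite !hd_sum; apply: eq_bigr => i _; rewrite !ffunE.
by case: (u i); case: (v i); case: (a i).
Qed.

End Wperm.

(** * Words as bit lists, in a form that computes *)

Definition of_bits m (s : seq bool) : word m := [ffun i : 'I_m => nth false s i].

Fixpoint flip_at i (s : seq bool) : seq bool :=
  match s, i with
  | [::], _ => [::]
  | b :: s', 0 => negb b :: s'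
  | b :: s', i'.+1 => b :: flip_at i' s'
  end.

Fixpoint hds (s t : seq bool) : nat :=
  match s, t with
  | a :: s', b :: t' => if addb a b then (hds s' t').+1 else hds s' t'
  | _, _ => 0
  end.

Fixpoint eqbits (s t : seq bool) : bool :=
  match s, t with
  | [::], [::] => true
  | a :: s', b :: t' => if addb a b then false else eqbits s' t'
  | _, _ => false
  end.

Lemma eqbitsP s t : eqbits s t -> s = t.
Proof.
elim: s t => [|a s IH] [|b t] //=; case: a; case: b => //= /IH -> //.
Qed.

Lemma size_flip_at i s : size (flip_at i s) = size s.
Proof. by elim: s i => [|b s IH] [|i] //=; rewrite IH. Qed.

Lemma of_bits_flip m (i : 'I_m) s : size s = m -> of_bits m (flip_at i s) = flip (of_bits m s) i.
Proof.
move=> hs; apply/ffunP => j; rewrite !ffunE -val_eqE /=.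
have : i < size s by rewrite hs.
case: i j => i _ [j _] /= {hs}; elim: s i j => [|b s IH] [|i] [|j] //=.
- by rewrite addbT.
- by rewrite addbF.
- by rewrite addbF.
- by rewrite ltnS eqSS; apply: IH.
Qed.

Lemma hd_of_bits m s t : size s = m -> size t = m -> hd (of_bits m s) (of_bits m t) = hds s t.
Proof.
move=> hs ht; rewrite hd_sum.
rewrite (eq_bigr (fun i : 'I_m => (nth false s i != nth false t i) : nat)) => [|i _]; last by rewrite !ffunE.
elim: s t m hs ht => [|a s IH] [|b t] [|m] //=; first by rewrite big_ord0.
move=> [hs] [ht]; rewrite big_ord_recl /= (IH _ _ hs ht).
by case: a; case: b.
Qed.

(** Distance 0 is allowed, because the word sought may already be known; otherwise the distance must
    be at least 6. *)
Definition compatible (K : seq (seq bool)) v :=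
  all (fun k => if hds k v is d.+1 then 4 < d else true) K.

Definition pairs16 := [seq (i, j) | i <- iota 0 16, j <- iota i.+1 (15 - i)].

(** A pair containing the coordinate already flipped gives a word at distance 1 from [w]. In a run
    [compatible] rejects it: it is at distance 2 or 4 from the word that [w] was built from. *)
Definition candidates w p q :=
  [seq flip_at ij.1 (flip_at ij.2 w') | w' <- [:: flip_at p w; flip_at q w], ij <- pairs16].

Lemma hd_succ m (u c : word m) k : hd u c = k.+1 -> exists2 i, u i != c i & hd (flip u i) c = k.
Proof.
move=> h; have /existsP[i ni] : [exists i, u i != c i].
  apply: contraTT (isT : 0 < k.+1) => /existsPn e; rewrite -h -leqNgt leqn0 hd_eq0.
  by apply/eqP/ffunP => i; apply/eqP; have := e i; rewrite negbK.
by exists i => //; have := hd_flip u i c; rewrite ni (negPf ni) h /=; lia.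
Qed.

Lemma flipC m (u : word m) i j : flip (flip u i) j = flip (flip u j) i.
Proof. by apply/ffunP => k; rewrite !ffunE addbAC. Qed.

Lemma mem_candidates w (p q : 'I_16) c : size w = 16 -> hd (of_bits 16 w) c = 3 ->
  (of_bits 16 w p != c p) || (of_bits 16 w q != c q) ->
  exists2 v, v \in candidates w p q & size v = 16 /\ of_bits 16 v = c.
Proof.
move=> hw h3 hpq.
have [r hr nr] : exists2 r : 'I_16, of_bits 16 w r != c r & flip_at r w \in [:: flip_at p w; flip_at q w].
  by case/orP: hpq; [exists p|exists q] => //; rewrite !inE eqxx ?orbT.
have h2 : hd (flip (of_bits 16 w) r) c = 2.
  by have := hd_flip (of_bits 16 w) r c; rewrite hr (negPf hr) h3 /=; lia.
have [i _ h1] := hd_succ h2; have [j _ /eqP h0] := hd_succ h1.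
move: h0; rewrite hd_eq0 => /eqP ec.
have nij : i != j.
  by apply/eqP => ij; move: h2; rewrite -ec ij flipK hdvv.
wlog lij : i j {h1} ec nij / i < j.
  move=> H; have [lt|gt|/val_inj e] := ltngtP i j; first exact: (H i j).
    by apply: (H j i) => //; rewrite 1?eq_sym // flipC.
  by rewrite e eqxx in nij.
exists (flip_at i (flip_at j (flip_at r w))).
  apply/allpairsP; exists (flip_at r w, (val i, val j)); split => //=.
  apply/allpairsPdep; exists (val i), (val j); rewrite !mem_iota /= ltn_ord; split => //.
  by have := ltn_ord j; lia.
rewrite !size_flip_at hw; split => //.
by rewrite !of_bits_flip ?size_flip_at // flipC.
Qed.

Definition column (A : seq (seq bool)) i := [seq nth false w i | w <- A].

(** Greedy matching is enough, since equal columns are interchangeable. The default 16 marks a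
    failure, which [perm_code] detects. *)
Fixpoint match_columns A B (us js : seq nat) : seq nat :=
  if us is i :: us' then
    let j := head 16 [seq j <- js | eqbits (column B j) (column A i)] in
    j :: match_columns A B us' [seq k <- js | ~~ eqn k j]
  else [::].

Definition perm_code (f : seq nat) :=
  [&& size f == 16, uniq f, all (fun i => i < 16) f & take 3 f == [:: 0; 1; 2]].

Definition isomorphic A B :=
  let f := 0 :: 1 :: 2 :: match_columns A B (iota 3 13) (iota 3 13) in
  perm_code f && all (fun i => eqbits (column A i) (column B (nth 16 f i))) (iota 0 16).

Definition fixes3 (s : {perm 'I_16}) := forall i : 'I_16, i < 3 -> s i = i.

Lemma perm_of_code f : perm_code f -> exists2 s : {perm 'I_16}, fixes3 s & forall i, val (s i) = nth 16 f i.
Proof.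
case/and4P => /eqP hs hu /allP hlt /eqP h3.
pose g (i : 'I_16) : 'I_16 := inord (nth 16 f i).
have gE i : val (g i) = nth 16 f i by rewrite /= inordK // hlt // mem_nth // hs.
have g_inj : injective g.
  move=> i j /(congr1 val); rewrite !gE => /eqP; rewrite nth_uniq ?hs // => /eqP; exact: val_inj.
exists (perm g_inj) => [i hi|i]; last by rewrite permE gE.
apply: val_inj; rewrite permE gE -(nth_take _ hi) h3.
by case: i hi => [[|[|[|//]]]].
Qed.

Lemma isomorphicP A B : isomorphic A B -> exists2 s, fixes3 s &
  forall k, k < size A -> of_bits 16 (nth [::] A k) = wperm s (of_bits 16 (nth [::] B k)).
Proof.
case/andP => /perm_of_code [s s3 sE] /allP h; exists s => // k hk.
apply/ffunP => i; rewrite !ffunE sE.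
have /eqbitsP e : eqbits (column A i)
    (column B (nth 16 (0 :: 1 :: 2 :: match_columns A B (iota 3 13) (iota 3 13)) i)).
  by apply: h; rewrite mem_iota /=.
have sz : size A = size B by have := congr1 size e; rewrite !size_map.
have := congr1 (fun x => nth false x k) e.
by rewrite !(nth_map [::]) // -sz.
Qed.

(** The invariant of the reconstruction, stated up to permutations fixing 0, 1, 2 because its case
    splits are made only up to these. *)
Definition relabels_into (N K : seq (seq bool)) := forall C, locally_3design C ->
  (forall k, k \in K -> of_bits 16 k \in C) ->
  exists2 s, fixes3 s & forall n, n \in N -> of_bits 16 n \in [set wperm s c | c in C].

Lemma relabels_into_perm N K C s : relabels_into N K -> locally_3design C -> fixes3 s ->
  (forall k, k \in K -> of_bits 16 k \in [set wperm s c | c in C]) ->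
  exists2 t, fixes3 t & forall n, n \in N -> of_bits 16 n \in [set wperm t c | c in C].
Proof.
move=> hK hC s3 sub.
have [t t3 tN] := hK _ (locally_3design_imset (wpermK s) (wpermKV s) (hd_wperm s) hC) sub.
exists (t * s)%g => [i hi|n /tN]; first by rewrite permM t3 // s3.
case/imsetP => _ /imsetP[c cC ->] ->; apply/imsetP; exists c => //.
exact: wpermM.
Qed.

Section Run.
Variables (N : seq (seq bool)) (final : seq nat).

(* [K] lists words known to lie in the code. The rule [:: c; i; j; k; p; q] looks at the vertex
   obtained from the [c]-th word of [K] by flipping the coordinates [i], [j] and [k]: some codeword at
   distance 3 from that vertex differs from it at [p] or [q]. *)
Definition rule_vertex (K : seq (seq bool)) (r : seq nat) :=
  flip_at (nth 16 r 1) (flip_at (nth 16 r 2) (flip_at (nth 16 r 3) (nth [::] K (nth 0 r 0)))).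

Definition survivors (K : seq (seq bool)) (r : seq nat) :=
  [seq v <- candidates (rule_vertex K r) (nth 16 r 4) (nth 16 r 5) | compatible K v].

Definition applicable (K : seq (seq bool)) (r : seq nat) :=
  [&& nth 0 r 0 < size K, hds (rule_vertex K r) (nth [::] K (nth 0 r 0)) == 3,
      nth 16 r 4 < 16, nth 16 r 5 < 16 & nth 16 r 4 != nth 16 r 5].

(* The orders say in which order the words of [K] and [v] correspond to those of [K] and [v0]. *)
Definition interchangeable (K : seq (seq bool)) v0 (orders : seq (seq nat)) v :=
  eqbits v v0 ||
  has (fun o => isomorphic (rcons K v0) [seq nth v K l | l <- o]) (iota 0 (size K).+1 :: orders).

Definition relabelled (K : seq (seq bool)) : bool :=
  let K' := [seq [seq nth false k i | i <- final] | k <- K] in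
  perm_code final && all (fun n => has (eqbits n) K') N.

Fixpoint run (script : seq (seq nat * seq (seq nat))) K : bool :=
  match script with
  | [::] => relabelled K
  | (r, orders) :: script' =>
    applicable K r && if survivors K r is v0 :: vs then
      all (interchangeable K v0 orders) vs && run script' (rcons K v0)
    else true
  end.

(** Each rule yields a codeword among its survivors. If it is not [v0], an isomorphism fixing 0, 1,
    2 carries the code to one containing [K] and [v0], so the branch of [v0] suffices. *)
Lemma run_sound script K : all (fun k => size k == 16) K -> all (fun n => size n == 16) N ->
  run script K -> relabels_into N K.
Proof.
move=> sK sN; elim: script K sK => [|[r orders] script IH] K sK.
  case/andP => /[dup] hf /perm_of_code [s s3 sE] /allP hN C hC sub; exists s => // n nN.
  have /hasP[_ /mapP[k kK ->] /eqbitsP e] := hN n nN.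
  apply/imsetP; exists (of_bits 16 k); first exact: sub.
  apply/ffunP => i; rewrite !ffunE sE e (nth_map 16) //.
  by case/and4P: hf => /eqP ->.
case/andP => /and5P[hci /eqP hw hp hq npq] hrun C hC sub.
set ci := nth 0 r 0 in hci hw; set p := nth 16 r 4 in hp npq; set q := nth 16 r 5 in hq npq.
set w := rule_vertex K r in hw.
set kc := nth [::] K ci in hw.
have kcK : kc \in K by apply: mem_nth.
have skc : size kc = 16 by apply/eqP/(allP sK).
have sw : size w = 16 by rewrite !size_flip_at.
have h3 : hd (of_bits 16 w) (of_bits 16 kc) = 3 by rewrite hd_of_bits.
have [c cC [hc hpq]] := codeword_through (p := Ordinal hp) (q := Ordinal hq) hC (sub _ kcK) h3 npq.
have [v vcand [sv ev]] := mem_candidates sw hc hpq.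
have dC := hC.1.
have : v \in survivors K r.
  rewrite mem_filter vcand andbT; apply/allP => l lK.
  have sl : size l = 16 by apply/eqP/(allP sK).
  rewrite -(hd_of_bits sl sv) ev.
  have [e|ne] := eqVneq (of_bits 16 l) c; first by rewrite e hdvv.
  by have := dC _ _ (sub _ lK) cC ne; case: (hd _ _).
case E : (survivors K r) hrun => [|v0 vs] // /andP[/allP hall hrun].
have sv0 : size v0 = 16.
  have : v0 \in survivors K r by rewrite E mem_head.
  rewrite mem_filter => /andP[_ /allpairsP [[w' ij] /= [w'in _ ->]]].
  by move: w'in; rewrite !size_flip_at !inE => /orP[] /eqP ->; rewrite size_flip_at.
have {IH hrun} good : relabels_into N (rcons K v0).
  by apply: IH => //; rewrite all_rcons sv0 eqxx.
have base : v = v0 -> exists2 s, fixes3 s & forall n, n \in N -> of_bits 16 n \in [set wperm s c | c in C].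
  move=> e; apply: good => // l; rewrite mem_rcons inE => /orP[/eqP ->|/sub //].
  by rewrite -e ev.
rewrite inE => /orP[/eqP //|/hall /orP[/eqbitsP //|/hasP [o _ iso]]].
have [s s3 sE] := isomorphicP iso.
apply: (relabels_into_perm good hC s3) => l.
have szo : size (rcons K v0) = size [seq nth v K l | l <- o].
  case/andP: iso => _ /allP /(_ 0 isT) /eqbitsP /(congr1 size).
  by rewrite !size_map.
move=> lin; rewrite -(nth_index [::] lin) sE ?index_mem //; apply/imsetP; eexists; last by [].
have hi : index l (rcons K v0) < size o by rewrite -(size_map (nth v K)) -szo index_mem.
(* The index [size K] is out of range in [K] and stands for [v], the default of [nth]. *)
rewrite (nth_map 0) //; set x := nth 0 o _.
have [lt|ge] := ltnP x (size K); first by apply/sub/mem_nth.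
by rewrite nth_default // ev.
Qed.

End Run.

(** * The Nordstrom-Robinson code *)

Fixpoint row_span (n : nat) (rows : seq (seq bool)) : seq (seq bool) :=
  if rows is r :: rows' then
    let S := row_span n rows' in S ++ [seq [seq addb ab.1 ab.2 | ab <- zip r w] | w <- S]
  else [:: nseq n false].

Definition NR_prefixes : seq (seq bool) :=
  nseq 8 false :: [seq [seq eqn j i || eqn j 7 | j <- iota 0 8] | i <- iota 0 7].

Definition NR_words : seq (seq bool) :=
  [seq drop 8 w | w <- row_span 24 [seq [seq eqn x 1 | x <- r] | r <- golay_rows]
     & has (eqbits (take 8 w)) NR_prefixes].

(** Where no order is listed, the survivors are equivalent under permutations fixing 0, 1, 2 and
    each known word. The listed orders permute known words too. *)
Definition branching_rules : seq (seq nat * seq (seq nat)) := [::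
  ([:: 0; 0; 1; 2; 3; 6], [::]); ([:: 0; 0; 1; 2; 6; 9], [::]); ([:: 0; 0; 1; 2; 9; 12], [::]);
  ([:: 0; 0; 1; 2; 12; 13], [::]);
  ([:: 0; 0; 1; 15; 2; 3], [:: [:: 0; 1; 2; 4; 3; 5]; [:: 0; 1; 3; 4; 2; 5]]);
  ([:: 0; 0; 1; 3; 7; 12], [::]); ([:: 0; 0; 1; 3; 8; 11], [::]);
  ([:: 0; 0; 1; 15; 2; 12], [:: [:: 0; 1; 3; 2; 4; 5; 6; 7; 8]]); ([:: 0; 0; 1; 9; 8; 12], [::]);
  ([:: 0; 0; 1; 9; 4; 7], [::]); ([:: 0; 0; 1; 10; 4; 8], [::]); ([:: 0; 0; 1; 5; 6; 12], [::]);
  ([:: 0; 0; 1; 5; 7; 10], [::]); ([:: 0; 0; 1; 7; 5; 11], [::]);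
  ([:: 1; 2; 3; 12; 0; 13], [:: [:: 0; 3; 4; 2; 1; 14; 12; 7; 13; 10; 6; 11; 9; 5; 8; 15]])].

(* Each of these rules leaves a single word. *)
Definition forced_rules : seq (seq nat) := [::
  [:: 0; 1; 2; 7; 4; 10]; [:: 0; 0; 4; 7; 2; 12]; [:: 0; 0; 2; 4; 8; 10]; [:: 0; 0; 2; 3; 6; 11];
  [:: 0; 0; 2; 3; 7; 10]; [:: 0; 0; 2; 3; 8; 9]; [:: 0; 0; 2; 4; 6; 9]; [:: 0; 0; 2; 5; 6; 9];
  [:: 0; 0; 2; 5; 7; 10]; [:: 0; 0; 2; 5; 8; 11]; [:: 0; 0; 2; 6; 4; 10]; [:: 0; 0; 3; 4; 6; 9];
  [:: 0; 0; 3; 4; 7; 8]; [:: 0; 0; 3; 4; 9; 10]; [:: 0; 0; 3; 5; 6; 8]; [:: 0; 0; 3; 5; 7; 9];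
  [:: 0; 0; 3; 5; 12; 13]; [:: 0; 0; 3; 9; 4; 10]; [:: 0; 0; 4; 5; 6; 7]; [:: 0; 0; 4; 5; 8; 9];
  [:: 0; 0; 4; 5; 8; 11]; [:: 0; 0; 4; 6; 2; 8]; [:: 0; 0; 5; 7; 1; 8]; [:: 0; 0; 6; 7; 3; 9];
  [:: 0; 0; 6; 7; 3; 10]; [:: 0; 0; 6; 8; 12; 13]; [:: 0; 0; 7; 8; 9; 10];
  [:: 0; 0; 8; 10; 1; 11]; [:: 0; 0; 9; 11; 12; 13]; [:: 0; 1; 2; 3; 6; 13];
  [:: 0; 1; 2; 3; 7; 9]; [:: 0; 1; 2; 3; 8; 11]; [:: 0; 1; 2; 4; 6; 9]; [:: 0; 1; 2; 4; 8; 11];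
  [:: 0; 1; 2; 5; 6; 9]; [:: 0; 1; 2; 5; 7; 9]; [:: 0; 1; 2; 5; 8; 9]; [:: 0; 1; 2; 8; 3; 9];
  [:: 0; 1; 3; 4; 6; 7]; [:: 0; 1; 3; 4; 8; 9]; [:: 0; 1; 3; 4; 12; 13]; [:: 0; 1; 3; 5; 6; 7];
  [:: 0; 1; 3; 5; 6; 9]; [:: 0; 1; 3; 5; 6; 10]; [:: 0; 1; 3; 6; 5; 8]; [:: 0; 1; 4; 5; 6; 8];
  [:: 0; 1; 4; 5; 9; 10]; [:: 0; 1; 4; 10; 5; 11]; [:: 0; 1; 5; 6; 3; 7];
  [:: 0; 1; 6; 7; 12; 13]; [:: 0; 1; 6; 8; 9; 10]; [:: 0; 1; 6; 9; 8; 11]; [:: 0; 1; 7; 8; 4; 9];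
  [:: 0; 1; 7; 8; 4; 10]; [:: 0; 1; 9; 10; 12; 13]; [:: 0; 2; 3; 4; 6; 7]; [:: 0; 2; 3; 4; 7; 9];
  [:: 0; 2; 3; 4; 7; 10]; [:: 0; 2; 3; 5; 6; 7]; [:: 0; 2; 3; 5; 8; 11]; [:: 0; 2; 3; 5; 9; 10];
  [:: 0; 2; 3; 7; 4; 8]; [:: 0; 2; 4; 5; 6; 10]; [:: 0; 2; 4; 5; 7; 8]; [:: 0; 2; 4; 5; 12; 13];
  [:: 0; 2; 4; 6; 0; 7]; [:: 0; 2; 5; 9; 1; 11]; [:: 0; 2; 6; 7; 9; 10]; [:: 0; 2; 6; 8; 5; 9];
  [:: 0; 2; 6; 8; 5; 11]; [:: 0; 2; 7; 8; 12; 13]; [:: 0; 2; 7; 9; 0; 10];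
  [:: 0; 2; 10; 11; 12; 13]; [:: 0; 3; 4; 5; 6; 9]; [:: 0; 3; 4; 5; 7; 10];
  [:: 0; 3; 4; 5; 8; 11]; [:: 0; 3; 4; 7; 2; 9]; [:: 0; 3; 5; 6; 1; 11]; [:: 0; 3; 6; 7; 0; 8];
  [:: 0; 3; 6; 7; 0; 10]; [:: 0; 3; 6; 9; 2; 10]; [:: 0; 3; 7; 11; 12; 13];
  [:: 0; 3; 8; 9; 5; 11]; [:: 0; 3; 8; 10; 12; 13]; [:: 0; 4; 5; 8; 0; 10];
  [:: 0; 4; 6; 7; 8; 9]; [:: 0; 4; 6; 9; 7; 10]; [:: 0; 4; 6; 11; 12; 13];
  [:: 0; 4; 7; 8; 1; 11]; [:: 0; 4; 7; 9; 6; 10]; [:: 0; 4; 8; 9; 12; 13];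
  [:: 0; 5; 6; 7; 8; 11]; [:: 0; 5; 6; 8; 2; 9]; [:: 0; 5; 6; 10; 12; 13];
  [:: 0; 5; 7; 9; 12; 13]; [:: 0; 5; 7; 10; 8; 11]; [:: 0; 5; 8; 9; 3; 10];
  [:: 1; 0; 1; 7; 5; 11]; [:: 1; 0; 2; 6; 4; 10]; [:: 1; 0; 3; 9; 4; 10]; [:: 1; 0; 4; 6; 2; 8];
  [:: 1; 0; 5; 7; 1; 8]; [:: 1; 0; 6; 7; 3; 8]; [:: 1; 0; 6; 7; 3; 9]; [:: 1; 0; 6; 11; 12; 13];
  [:: 1; 0; 7; 9; 2; 10]; [:: 1; 0; 8; 9; 12; 13]; [:: 1; 0; 8; 10; 1; 11];
  [:: 1; 1; 2; 8; 3; 9]; [:: 1; 1; 3; 6; 5; 8]; [:: 1; 1; 4; 10; 5; 11]; [:: 1; 1; 5; 6; 3; 7];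
  [:: 1; 1; 6; 7; 8; 11]; [:: 1; 1; 6; 9; 8; 11]; [:: 1; 1; 6; 10; 12; 13];
  [:: 1; 1; 7; 8; 4; 10]; [:: 1; 1; 7; 9; 12; 13]; [:: 1; 1; 8; 9; 6; 10]; [:: 1; 2; 3; 7; 4; 8];
  [:: 1; 2; 4; 6; 0; 7]; [:: 1; 2; 5; 9; 1; 11]; [:: 1; 2; 6; 7; 8; 9]; [:: 1; 2; 6; 8; 5; 11];
  [:: 1; 2; 6; 9; 3; 10]; [:: 1; 2; 7; 9; 0; 10]; [:: 1; 2; 7; 11; 12; 13];
  [:: 1; 2; 8; 10; 12; 13]; [:: 1; 3; 4; 7; 2; 9]; [:: 1; 3; 5; 6; 1; 11]; [:: 1; 3; 6; 7; 0; 9];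
  [:: 1; 3; 6; 7; 0; 10]; [:: 1; 3; 6; 8; 9; 10]; [:: 1; 3; 7; 8; 12; 13];
  [:: 1; 3; 8; 9; 5; 11]; [:: 1; 3; 10; 11; 12; 13]; [:: 1; 4; 5; 8; 0; 10];
  [:: 1; 4; 6; 7; 9; 10]; [:: 1; 4; 6; 8; 12; 13]; [:: 1; 4; 6; 9; 7; 10]; [:: 1; 4; 7; 8; 1; 9];
  [:: 1; 4; 7; 8; 1; 11]; [:: 1; 4; 9; 11; 12; 13]; [:: 1; 5; 6; 7; 12; 13];
  [:: 1; 5; 6; 8; 2; 9]; [:: 1; 5; 6; 8; 2; 10]; [:: 1; 5; 7; 8; 9; 10]; [:: 1; 5; 7; 10; 8; 11];
  [:: 1; 5; 9; 10; 12; 13]; [:: 2; 0; 1; 5; 7; 10]; [:: 2; 0; 2; 4; 6; 9];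
  [:: 2; 0; 3; 9; 4; 10]; [:: 2; 0; 3; 11; 12; 13]; [:: 2; 0; 4; 5; 8; 11];
  [:: 2; 0; 4; 9; 3; 10]; [:: 2; 0; 5; 9; 12; 13]; [:: 2; 0; 8; 10; 1; 11];
  [:: 2; 1; 2; 3; 8; 11]; [:: 2; 1; 3; 5; 6; 9]; [:: 2; 1; 3; 10; 12; 13];
  [:: 2; 1; 4; 9; 12; 13]; [:: 2; 1; 4; 10; 5; 11]; [:: 2; 1; 5; 9; 2; 10];
  [:: 2; 1; 6; 9; 8; 11]; [:: 2; 2; 3; 4; 7; 10]; [:: 2; 2; 3; 9; 6; 10];
  [:: 2; 2; 4; 11; 12; 13]; [:: 2; 2; 5; 9; 1; 11]; [:: 2; 2; 5; 10; 12; 13];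
  [:: 2; 2; 7; 9; 0; 10]; [:: 2; 3; 8; 9; 5; 11]; [:: 2; 4; 6; 9; 7; 10];
  [:: 2; 5; 7; 10; 8; 11]; [:: 2; 6; 10; 11; 12; 13]; [:: 2; 7; 9; 11; 12; 13];
  [:: 2; 8; 9; 10; 12; 13]; [:: 3; 0; 1; 4; 8; 11]; [:: 3; 0; 2; 3; 7; 10];
  [:: 3; 0; 3; 4; 6; 9]; [:: 3; 0; 3; 8; 12; 13]; [:: 3; 0; 5; 6; 12; 13]; [:: 3; 0; 5; 7; 1; 8];
  [:: 3; 1; 2; 5; 6; 9]; [:: 3; 1; 3; 6; 5; 8]; [:: 3; 1; 3; 7; 12; 13]; [:: 3; 1; 4; 5; 7; 10];
  [:: 3; 1; 4; 6; 12; 13]; [:: 3; 2; 3; 5; 8; 11]; [:: 3; 2; 4; 6; 0; 7];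
  [:: 3; 2; 4; 8; 12; 13]; [:: 3; 2; 5; 7; 12; 13]; [:: 4; 0; 1; 3; 6; 9];
  [:: 4; 0; 2; 5; 8; 11]; [:: 4; 0; 3; 5; 7; 10]; [:: 4; 0; 4; 6; 2; 8]; [:: 4; 0; 4; 7; 9; 10];
  [:: 4; 1; 2; 4; 7; 10]; [:: 4; 1; 3; 4; 8; 11]; [:: 4; 1; 5; 6; 3; 7]; [:: 4; 1; 5; 8; 9; 10];
  [:: 4; 2; 3; 6; 9; 10]; [:: 4; 2; 3; 7; 4; 8]; [:: 4; 2; 4; 5; 6; 9]; [:: 5; 0; 4; 8; 5; 11];
  [:: 5; 0; 5; 7; 1; 11]; [:: 5; 0; 5; 8; 4; 10]; [:: 5; 1; 4; 7; 8; 11]; [:: 5; 1; 4; 8; 7; 10];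
  [:: 5; 1; 5; 7; 0; 10]; [:: 6; 0; 1; 5; 7; 8]; [:: 6; 0; 4; 6; 2; 9]; [:: 6; 0; 4; 8; 5; 11];
  [:: 6; 0; 5; 6; 8; 11]; [:: 6; 1; 4; 5; 6; 10]; [:: 6; 1; 4; 8; 7; 9]; [:: 7; 0; 1; 4; 6; 10];
  [:: 7; 0; 4; 5; 7; 8]; [:: 7; 1; 5; 6; 3; 9]; [:: 7; 1; 5; 7; 0; 10]; [:: 8; 0; 5; 7; 1; 9];
  [:: 8; 1; 5; 6; 3; 10]; [:: 8; 1; 5; 7; 0; 9]; [:: 9; 0; 4; 6; 2; 10]; [:: 9; 1; 4; 6; 7; 10];
  [:: 10; 0; 1; 5; 6; 7]; [:: 11; 0; 5; 7; 1; 11]; [:: 15; 1; 2; 6; 9; 10];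
  [:: 15; 1; 2; 8; 3; 10]; [:: 15; 1; 3; 6; 5; 8]; [:: 16; 1; 3; 6; 5; 11];
  [:: 16; 1; 3; 8; 2; 9]; [:: 17; 0; 3; 6; 7; 8]; [:: 18; 0; 3; 5; 6; 9]; [:: 19; 0; 5; 7; 1; 9];
  [:: 19; 0; 5; 8; 4; 10]; [:: 20; 0; 5; 8; 4; 9]; [:: 22; 0; 5; 6; 8; 11];
  [:: 29; 0; 5; 6; 7; 8]; [:: 29; 0; 5; 9; 12; 13]; [:: 39; 0; 8; 10; 1; 11];
  [:: 118; 0; 9; 11; 12; 13]].

(** Matches the coordinates of the constructed code with those of [NR]. *)
Definition final_relabelling := [:: 0; 1; 2; 5; 15; 4; 14; 12; 8; 11; 9; 7; 3; 6; 13; 10].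

Definition construction := branching_rules ++ [seq (r, [::]) | r <- forced_rules].
(** The whole case analysis, starting from the origin alone. *)
Lemma construction_run : run NR_words final_relabelling construction [:: nseq 16 false].
Proof. by vm_compute. Qed.

(** * Agreement of the bit lists with the Golay code and [NR] *)

Lemma eqbits_eq s t : eqbits s t = (s == t).
Proof.
by elim: s t => [|a s IH] [|b t] //=; rewrite eqseq_cons -IH; case: a; case: b.
Qed.

Lemma nth_zip_addb n (r w : seq bool) j : size r = n -> size w = n ->
  nth false [seq addb ab.1 ab.2 | ab <- zip r w] j = nth false r j (+) nth false w j.
Proof.
move=> <- {n}; elim: r w j => [|a r IH] [|b w] [|j] //= [hs]; exact: IH.
Qed.

Lemma row_spanP n rows w : all (fun r => size r == n) rows ->
  reflect (size w = n /\ exists u : nat -> bool, forall j, nth false w j =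
    \big[xorb/false]_(i < size rows) (u i && nth false (nth [::] rows i) j)) (w \in row_span n rows).
Proof.
have xorbE a b : xorb a b = a (+) b by case: a; case: b.
elim: rows w => [|r rows IH] w /=.
  move=> _; rewrite inE; apply: (iffP eqP) => [->|[sw [u hu]]].
    by split; [rewrite size_nseq|exists xpred0 => j; rewrite big_ord0 nth_nseq if_same].
  apply: (@eq_from_nth _ false); rewrite ?size_nseq // => j _.
  by rewrite hu big_ord0 nth_nseq if_same.
case/andP => /eqP sr srows; rewrite mem_cat; apply: (iffP orP).
  case=> [/(IH _ srows) [sw [u hu]]|/mapP[v /(IH _ srows) [sv [u hu]] ->]]; split => //.
  - by exists (fun i => if i is i'.+1 then u i' else false) => j; rewrite big_ord_recl /= hu.
  - by rewrite size_map size_zip sr sv minnn.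
  - exists (fun i => if i is i'.+1 then u i' else true) => j.
    by rewrite big_ord_recl /= (nth_zip_addb _ sr sv) hu xorbE.
case=> sw [u hu]; case u0 : (u 0); last first.
  left; apply/(IH _ srows); split => //; exists (fun i => u i.+1) => j.
  by rewrite hu big_ord_recl u0.
(* The first row occurs in [w], so adding it again leaves a word in the span of the others. *)
right; pose v := [seq addb ab.1 ab.2 | ab <- zip r w].
have vE j := nth_zip_addb j sr sw.
apply/mapP; exists v.
  apply/(IH _ srows); split; first by rewrite size_map size_zip sr sw minnn.
  exists (fun i => u i.+1) => j; rewrite vE hu big_ord_recl u0 /= xorbE.
  by rewrite addbA addbb.
have sv : size v = n by rewrite size_map size_zip sr sw minnn.
apply: (@eq_from_nth _ false) => [|j _]; first by rewrite size_map size_zip sr sv sw minnn.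
by rewrite (nth_zip_addb _ sr sv) vE addbA addbb.
Qed.

Lemma golayP a : reflect
  (exists2 w, size w = 24 /\ w \in row_span 24 [seq [seq eqn x 1 | x <- r] | r <- golay_rows]
  & a = of_bits 24 w) (a \in golay).
Proof.
set rows := map _ _.
have srows : all (fun r => size r == 24) rows by [].
have rowE i j : nth false (nth [::] rows i) j = (nth 0 (nth [::] golay_rows i) j == 1).
  have h s : nth false [seq eqn x 1 | x <- s] j = (nth 0 s j == 1).
    by elim: s j => [|x s IH] [|j] //=.
  have [lt|ge] := ltnP i (size golay_rows); first by rewrite (nth_map [::]).
  by rewrite !nth_default ?size_map.
apply: (iffP imsetP) => [[u _ ->]|[w [sw /(row_spanP _ srows) [_ [u hu]]] ->]].
  pose w := mkseq (fun j => \big[xorb/false]_(i < 12) (u i && nth false (nth [::] rows i) j)) 24.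
  have wE : forall j, j < 24 -> nth false w j =
     \big[xorb/false]_(i < 12) (u i && nth false (nth [::] rows i) j).
    by move=> j hj; rewrite nth_mkseq.
  exists w; first split; rewrite ?size_mkseq //.
    apply/(row_spanP _ srows); split; first by rewrite size_mkseq.
    exists (fun i => u (inord i)) => j; have [hj|hj] := ltnP j 24.
      by rewrite wE //; apply: eq_bigr => i _; rewrite inord_val.
    (* From position 24 on, both sides are the default [false]. *)
    rewrite nth_default ?size_mkseq //; apply/esym.
    apply: (big_ind (fun x => x = false)) => [|x y -> ->|i _] //.
    rewrite [nth false (nth _ _ _) j]nth_default ?andbF //.
    by rewrite (eqP (allP srows _ (mem_nth _ (ltn_ord i)))).
  apply/ffunP => j; rewrite !ffunE wE //; apply: eq_bigr => i _.
  by rewrite rowE.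
exists [ffun i : 'I_12 => u i]; first by rewrite inE.
apply/ffunP => j; rewrite !ffunE hu; apply: eq_bigr => i _.
by rewrite ffunE rowE.
Qed.

(** Taking [P] empty or the pair of i and 7 covers both alternatives in [NR_B]. *)
Lemma supp_Jstar w (P : pred nat) : size w = 24 -> (forall j, P j -> j < 8) ->
  (supp (of_bits 24 w) :&: Jstar == [set j : 'I_24 | P j]) = eqbits (take 8 w) [seq P j | j <- iota 0 8].
Proof.
move=> sw hP; rewrite eqbits_eq.
have sQ : size [seq P j | j <- iota 0 8] = 8 by rewrite size_map size_iota.
have QE j : j < 8 -> nth false [seq P j | j <- iota 0 8] j = P j.
  by move=> hj; rewrite (nth_map 0) ?size_iota // nth_iota.
move: [seq P j | j <- iota 0 8] sQ QE => Q sQ QE.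
have sT : size (take 8 w) = 8 by rewrite size_take sw.
apply/eqP/eqP => [/setP h|h].
  apply: (@eq_from_nth _ false); rewrite sT ?sQ // => j hj.
  have hj24 : j < 24 by apply: leq_trans hj _.
  have := h (Ordinal hj24); rewrite !inE ffunE /= hj andbT => e.
  by rewrite nth_take // e QE.
apply/setP => j; rewrite !inE ffunE; have [hj|hj] /= := ltnP j 8; last first.
  by rewrite andbF; apply/esym/negbTE/negP => /hP; rewrite ltnNge hj.
by rewrite andbT -(nth_take _ hj) h QE.
Qed.

Lemma NRP n : reflect (exists2 l, l \in NR_words & n = of_bits 16 l) (n \in NR).
Proof.
have prefixE w : size w = 24 ->
    ((supp (of_bits 24 w) :&: Jstar == set0) || [exists i : 'I_7,
       supp (of_bits 24 w) :&: Jstar == [set (inord i : 'I_24); (inord 7 : 'I_24)]]) =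
    has (eqbits (take 8 w)) NR_prefixes.
  move=> sw; have -> : has (eqbits (take 8 w)) NR_prefixes =
    eqbits (take 8 w) [seq xpred0 j | j <- iota 0 8] || has (eqbits (take 8 w))
      [seq [seq eqn j i || eqn j 7 | j <- iota 0 8] | i <- iota 0 7] by [].
  rewrite -(@supp_Jstar w xpred0) //.
  rewrite (_ : [set j : 'I_24 | xpred0 (val j)] = set0); last by apply/setP => j; rewrite !inE.
  have pairE (i : 'I_7) : (supp (of_bits 24 w) :&: Jstar == [set (inord i : 'I_24); (inord 7 : 'I_24)]) =
      eqbits (take 8 w) [seq eqn j i || eqn j 7 | j <- iota 0 8].
    rewrite -(@supp_Jstar w (fun j => eqn j i || eqn j 7)) //; last first.
      by move=> j /orP[] /eqnP ->; have := ltn_ord i; lia.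
    congr (_ == _); apply/setP => j; rewrite !inE -!val_eqE /= !inordK //.
    by apply: leq_trans (ltn_ord i) _.
  congr orb; apply/existsP/hasP => [[i]|[_ /mapP[i hi ->] h]].
    rewrite pairE => h; exists [seq eqn j i || eqn j 7 | j <- iota 0 8] => //.
    by apply/mapP; exists (val i) => //; rewrite mem_iota /=.
  by rewrite mem_iota in hi; exists (Ordinal hi); rewrite pairE.
have restrE w : size w = 24 -> restrJ (of_bits 24 w) = of_bits 16 (drop 8 w).
  move=> sw; apply/ffunP => j; rewrite !ffunE nth_drop addnC inordK //.
  by have := ltn_ord j; lia.
apply: (iffP imsetP) => [[a]|[l /mapP[w]]].
  rewrite inE => /andP[/golayP[w [sw ws] ->]]; rewrite prefixE // => h ->.
  exists (drop 8 w); last exact: restrE.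
  by apply/mapP; exists w => //; rewrite mem_filter h.
rewrite mem_filter => /andP[h ws] -> ->.
have sw : size w = 24.
  have srows : all (fun r => size r == 24) [seq [seq eqn x 1 | x <- r] | r <- golay_rows] by [].
  by have [] := row_spanP _ srows ws.
exists (of_bits 24 w); last by rewrite restrE.
by rewrite inE prefixE // h andbT; apply/golayP; exists w.
Qed.

Lemma size_NR_words : all (fun n => size n == 16) NR_words.
Proof. by vm_compute. Qed.

Lemma card_NR : #|NR| = 2 ^ 8.
Proof.
have -> : NR = [set n in [seq of_bits 16 l | l <- NR_words]].
  apply/setP => n; rewrite inE; apply/NRP/mapP => [[l]|[l]]; by exists l.
rewrite cardsE; have /card_uniqP -> : uniq [seq of_bits 16 l | l <- NR_words].
  rewrite map_inj_in_uniq; first by vm_compute.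
  move=> l l' /(allP size_NR_words) /eqP sl /(allP size_NR_words) /eqP sl' /ffunP e.
  apply: (@eq_from_nth _ false); rewrite sl // => j hj.
  by have := e (Ordinal hj); rewrite !ffunE.
by rewrite size_map; vm_compute.
Qed.

(** Moving [c0] to the origin and the coordinates by [sigma] allows the reconstruction to start; as
    it fixes 0, 1, 2, the values of [sigma] there survive. The inclusion obtained is an equality by
    size. *)
Lemma NR_unique C c0 (sigma : {perm 'I_16}) : locally_3design C -> #|C| = 2 ^ 8 -> c0 \in C ->
  exists2 s : {perm 'I_16}, (forall i : 'I_16, i < 3 -> s i = sigma i) &
    [set wperm s (wadd c c0) | c in C] = NR.
Proof.
move=> hC cardC c0C; pose f v := wperm sigma (wadd v c0).
pose g v := wadd (wperm sigma^-1 v) c0.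
have fK : cancel f g by move=> v; rewrite /g /f wpermK waddK.
have gK : cancel g f by move=> v; rewrite /g /f waddK wpermKV.
have hdf u v : hd (f u) (f v) = hd u v by rewrite hd_wperm hd_wadd.
have good := run_sound (K := [:: nseq 16 false]) isT size_NR_words construction_run.
have [|s s3 sN] := good _ (locally_3design_imset fK gK hdf hC).
  move=> k; rewrite inE => /eqP ->; apply/imsetP; exists c0 => //.
  by apply/ffunP => i; rewrite !ffunE nth_nseq if_same; case: (c0 _).
exists (s * sigma)%g => [i hi|]; first by rewrite permM s3.
apply/esym/eqP; rewrite eqEcard card_NR -cardC leq_imset_card andbT.
apply/subsetP => n /NRP[l lN ->]; have := sN l lN.
case/imsetP => _ /imsetP[c cC ->] ->; apply/imsetP; exists c => //.
exact: wpermM.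
Qed.

(** * Complete transitivity *)

Section HammingGroup.
Variable m : nat.
Implicit Types (s : {perm 'I_m}) (a u v : word m) (x y : {perm word m}).

Lemma HAutP x : reflect (exists a s, forall b, x b = wadd (wperm s b) a) (x \in HAut m).
Proof.
rewrite inE; apply: (iffP existsP) => [[a /existsP[s /forallP h]]|[a [s h]]]; exists a.
  by exists s => b; apply/eqP.
by apply/existsP; exists s; apply/forallP => b; apply/eqP.
Qed.

Lemma hd_HAut x u v : x \in HAut m -> hd (x u) (x v) = hd u v.
Proof. by case/HAutP => a [s h]; rewrite !h hd_wadd hd_wperm. Qed.

Lemma HAut_group_set : group_set (HAut m).
Proof.
apply/group_setP; split => [|x y /HAutP[a [s hx]] /HAutP[b [t hy]]]; apply/HAutP.
  exists [ffun=> false], 1%g => b; rewrite perm1 wperm1; apply/ffunP => i; rewrite !ffunE.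
  by case: (b i).
exists (wadd (wperm t a) b), (t * s)%g => c; rewrite permM hx hy -wpermM.
by apply/ffunP => i; rewrite !ffunE; case: (c _); case: (a _); case: (b _).
Qed.

Definition HAut_group := Group HAut_group_set.

Lemma affine_HAut s a : exists2 x, x \in HAut m & forall b, x b = wperm s (wadd b a).
Proof.
have inj : injective (fun b => wperm s (wadd b a)).
  by apply: inj_comp (can_inj (wpermK s)) (can_inj (waddK a)).
exists (perm inj) => [|b]; last by rewrite permE.
apply/HAutP; exists (wperm s a), s => b; rewrite permE.
by apply/ffunP => i; rewrite !ffunE.
Qed.

Variable C : {set word m}.

Definition code_auts := [set x in HAut m | [set x c | c in C] == C].

Lemma code_auts_group_set : group_set code_auts.
Proof.
apply/group_setP; split => [|x y].
  rewrite inE; apply/andP; split; first exact: (group1 HAut_group).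
  apply/eqP; rewrite -[RHS]imset_id.
  by apply: eq_imset => c; rewrite perm1.
rewrite inE => /andP[hx /eqP ex]; rewrite inE => /andP[hy /eqP ey].
rewrite inE; apply/andP; split; first exact: (groupM (G := HAut_group) hx hy).
apply/eqP; rewrite -[RHS]ey -{2}ex -imset_comp; apply: eq_imset => c.
by rewrite permM.
Qed.

Definition code_auts_group := Group code_auts_group_set.

(** Neither an automorphism nor its inverse can increase the distance to the code. *)
Lemma dcode_code_auts x v : C != set0 -> x \in code_auts -> dcode C (x v) = dcode C v.
Proof.
move=> C0; suff le y u : y \in code_auts -> dcode C (y u) <= dcode C u.
  move=> xX; apply/eqP; rewrite eqn_leq le //= -{1}(permK x v).
  by apply: le; apply: (groupVr (G := code_auts_group)).
rewrite inE => /andP[hy /eqP ey]; have [c cC <-] := dcode_attained u C0.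
by rewrite -(hd_HAut _ _ hy); apply: dcode_le; rewrite -{1}ey imset_f.
Qed.

End HammingGroup.

(** The permutation lists [E] first and then its complement. *)
Lemma perm_onto_prefix m (E : {set 'I_m}) :
  exists sigma : {perm 'I_m}, forall j, (sigma j \in E) = (j < #|E|).
Proof.
pose L := enum E ++ enum (~: E).
have sL : size L = m by rewrite size_cat -!cardE cardsC card_ord.
have uL : uniq L.
  rewrite cat_uniq !enum_uniq andbT /=; apply/hasPn => j; rewrite !mem_enum inE.
  by move/negPf => /= ->.
have inj : injective (fun j : 'I_m => nth j L j).
  move=> i j /eqP; rewrite (set_nth_default i) ?sL // nth_uniq ?sL // => /eqP.
  exact: val_inj.
exists (perm inj) => j; rewrite permE nth_cat -cardE; case: ltnP => h.
  by rewrite -mem_enum mem_nth // -cardE.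
apply/negbTE; rewrite -in_setC -mem_enum mem_nth // -cardE.
by rewrite -(ltn_add2l #|E|) cardsC card_ord subnKC.
Qed.

Lemma card_prefix m i : i <= m -> #|[set j : 'I_m | j < i]| = i.
Proof. by move=> h; rewrite -sum1dep_card (big_ord_narrow h) sum1_card card_ord. Qed.

(** * Transitivity from a normal form with [t] prescribed coordinates *)

Section CompleteTransitivity.
Variables (m t : nat) (C N : {set word m}).
Hypotheses (tm : t <= m) (C0 : C != set0).
Hypothesis normal_form : forall c0 (sigma : {perm 'I_m}), c0 \in C ->
  exists2 s : {perm 'I_m}, (forall i : 'I_m, i < t -> s i = sigma i) &
    [set wperm s (wadd c c0) | c in C] = N.
Hypothesis inhabited : forall i, i <= t -> exists v, dcode C v = i.
Hypothesis nup_top : forall v, dcode C v = t -> nup C v = 1.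
Hypothesis covering : forall v, dcode C v <= t.+1.
Implicit Types v : word m.

Lemma equivalent_normal_form : equivalent C N.
Proof.
have [c cC] := set0Pn _ C0; have [s _ e] := normal_form 1 cC.
have [x xH xE] := affine_HAut s c; exists x => //.
by rewrite -e; apply: eq_imset.
Qed.

(** Let [sigma] take the first coordinates to those where [v] differs from a nearest codeword.
    Normalising sends this codeword to the origin and [v] to a prefix of ones, which depends on its
    distance alone. *)
Lemma to_prefix v : dcode C v <= t ->
  exists2 x, x \in HAut m & [set x c | c in C] = N /\ x v = [ffun j : 'I_m => j < dcode C v].
Proof.
have [c cC <-] := dcode_attained v C0; pose E := [set j | v j != c j].
move=> hi; have [sigma sE] := perm_onto_prefix E.
have [s hs e] := normal_form sigma cC; have [x xH xE] := affine_HAut s c; exists x => //.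
split; first by rewrite -e; apply: eq_imset.
have cardE : #|E| = hd v c by [].
(* Only the values of [s] below [t] are known, but as [hd v c <= t] they already fill [E]. *)
have sA : [set s j | j in [set j : 'I_m | j < hd v c]] = E.
  apply/eqP; rewrite eqEcard card_imset; last exact: perm_inj.
  rewrite card_prefix ?hd_max // leqnn andbT; apply/subsetP => _ /imsetP[j + ->].
  by rewrite inE => hj; rewrite hs ?sE // (leq_trans hj).
apply/ffunP => j; rewrite xE !ffunE.
have -> : (j < hd v c) = (s j \in E) by rewrite -sA (mem_imset _ _ (@perm_inj _ s)) inE.
by rewrite inE; case: (v _); case: (c _).
Qed.

(** Both vertices reach the same prefix when [C] is carried onto [N]; one map followed by the
    inverse of the other preserves [C]. *)
Lemma code_auts_low_transitive v v' : dcode C v <= t -> dcode C v' = dcode C v ->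
  exists2 x, x \in code_auts C & x v = v'.
Proof.
move=> h e; have [x xH [xC xv]] := to_prefix h.
have [|y yH [yC yv]] := @to_prefix v'; first by rewrite e.
exists (x * y^-1)%g; last by rewrite permM xv -e -yv permK.
rewrite inE; apply/andP; split.
  by apply: (groupM (G := HAut_group m)) => //; apply: (groupVr (G := HAut_group m)).
apply/eqP.
rewrite (eq_imset _ (fun c => permM x y^-1 c)) imset_comp xC -yC -imset_comp.
by rewrite -[RHS]imset_id; apply: eq_imset => c /=; rewrite permK.
Qed.

(** At level t.+1, an automorphism matches downward neighbours of [v] and [v']. It sends [v] to an
    upward neighbour of the second one, whose only upward neighbour is [v']. *)
Lemma code_auts_transitive v v' : dcode C v' = dcode C v ->
  exists2 x, x \in code_auts C & x v = v'.
Proof.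
move=> e; have [h|h] := leqP (dcode C v) t; first exact: code_auts_low_transitive.
have ev : dcode C v = t.+1 by apply/eqP; rewrite eqn_leq covering.
have [|j hj] := @down_neighbour _ C C0 v; first by rewrite ev.
have [|j' hj'] := @down_neighbour _ C C0 v'; first by rewrite e ev.
have ew : dcode C (flip v j) = t by apply: succn_inj; rewrite -hj.
have ew' : dcode C (flip v' j') = t by apply: succn_inj; rewrite -hj' e.
have [||x xX xw] := @code_auts_low_transitive (flip v j) (flip v' j'); rewrite ?ew ?ew' //.
exists x => //; have xH : x \in HAut m by move: xX; rewrite inE => /andP[].
have [|k hk] := @hd_adjacent _ (flip v' j') (x v).
  rewrite -xw hd_HAut //; have := hd_flip v j v.
  by rewrite eqxx hdvv /=; lia.
have dk : dcode C (flip (flip v' j') k) = t.+1 by rewrite -hk dcode_code_auts.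
have := nup_top ew'; rewrite /nup ew' (bigD1 k) //= dk eqxx => /eqP.
rewrite eqSS sum_nat_eq0 => /forallP /(_ j'); rewrite flipK e ev eqxx.
by case: eqP => [jk _|//]; rewrite hk -jk flipK.
Qed.

Lemma completely_transitive_normal_form : completely_transitive C.
Proof.
exists (code_auts_group C) => [|i hi]; first by apply/subsetP => x; rewrite inE => /andP[].
have [g eg] : exists g, dcode C g = i.
  have le : i <= t.+1 by apply: leq_trans hi _; apply/bigmax_leqP.
  have [/inhabited //|lt] := leqP i t; have [v ev] := inhabited (leqnn t).
  have [|j hj] := @nup_neighbour _ C v; first by rewrite nup_top.
  by exists (flip v j); rewrite hj ev; apply/eqP; rewrite eqn_leq le lt.
exists g; apply/setP => v; rewrite inE; apply/eqP/orbitP => [ev|[x xX <-]].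
  by have [|x xX xg] := @code_auts_transitive g v; rewrite ?eg //; exists x.
by rewrite /= apermE dcode_code_auts.
Qed.

End CompleteTransitivity.

(** A codeword at distance 3 is a nearest one, since 3 is half of 6; hence the count is
    [outer C 3 3]. *)
Lemma locally_3design16 (C : {set word 16}) : completely_regular C -> min_dist C 6 -> locally_3design C.
Proof.
move=> crC dC; have [B33 _ _ _] := parameters16 crC dC; split; first exact: dC.2.
by move=> w c cC hw; rewrite (ncw_outer crC) (dcode_near dC.2 cC) hw.
Qed.

(** * Parity extension *)

Section ParityExtension.

Definition parity m (c : word m) : bool := odd (hd c [ffun=> false]).

(** Modulo 2 the distance is the sum of all bits of both words, so [v] cancels. *)
Lemma odd_hd m (u v w : word m) : odd (hd u w) = odd (hd u v) (+) odd (hd v w).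
Proof.
have oddE a b : odd (hd a b) = \big[addb/false]_(i < m) (a i (+) b i).
  rewrite hd_sum (big_morph odd oddD (erefl _)); apply: eq_bigr => i _.
  by case: (a i); case: (b i).
rewrite !oddE -big_split; apply: eq_bigr => i _ /=.
by case: (u i); case: (v i); case: (w i).
Qed.

(** The parity bit comes first because [puncture] deletes the first coordinate. *)
Definition extend m (c : word m) : word m.+1 :=
  [ffun j => if unlift ord0 j is Some k then c k else parity c].

Definition behead_word m (w : word m.+1) : word m := [ffun k => w (lift ord0 k)].

Lemma extendK m : cancel (@extend m) (@behead_word m).
Proof. by move=> c; apply/ffunP => k; rewrite !ffunE liftK. Qed.

Lemma hd_behead m (u v : word m.+1) : hd u v = (u ord0 != v ord0) + hd (behead_word u) (behead_word v).
Proof. by rewrite !hd_sum big_ord_recl; congr addn; apply: eq_bigr => k _; rewrite !ffunE. Qed.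

Lemma hd_extend m (c c' : word m) : hd (extend c) (extend c') = hd c c' + odd (hd c c').
Proof.
rewrite hd_behead !extendK addnC; congr addn.
rewrite !ffunE unlift_none (odd_hd c [ffun=> false]) (hdC [ffun=> false]) -/(parity c) -/(parity c').
by case: (parity c); case: (parity c').
Qed.

Lemma puncture_behead c : puncture c = behead_word c.
Proof.
by apply/ffunP => j; rewrite !ffunE; congr (c _); apply: val_inj; rewrite /= inordK // ltnS.
Qed.

Variable C : {set word 15}.
Hypotheses (crC : completely_regular C) (dC : min_dist C 5).

(** By parity, the extended codewords at distance 3 from [w] come from the codewords at distance 2
    or 3 from the punctured [v]. There are 1 + 4 of them if [v] is at level 2 and 0 + 5 at level
    3. *)
Lemma locally_3design_extend : locally_3design [set extend c | c in C].
Proof.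
have ext_inj := can_inj (@extendK 15).
have [B22 B23 B33 _ _] := parameters15 crC dC.
split=> [_ _ /imsetP[c cC ->] /imsetP[c' c'C ->]|w _ /imsetP[c cC ->] hw].
  rewrite (inj_eq ext_inj) hd_extend => n; have := dC.2 _ _ cC c'C n.
  by rewrite leq_eqVlt => /predU1P[<-//|lt]; apply: leq_trans (leq_addr _ _).
pose v := behead_word w.
have odd3 c' : odd (hd w (extend c')) by rewrite (odd_hd w (extend c)) hw hd_extend oddD oddb addbb.
have -> : ncw [set extend c | c in C] 3 w = ncw C 2 v + ncw C 3 v.
  rewrite !ncw_sum big_imset => [|a b _ _ /ext_inj //]; rewrite -big_split; apply: eq_bigr => c' _ /=.
  have := odd3 c'; rewrite hd_behead extendK -/v; move: (hd v c') => h.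
  by case: (_ != _) => /=; case: h => [|[|[|[|h]]]].
have hv : hd w (extend c) = (w ord0 != extend c ord0) + hd v c by rewrite hd_behead extendK.
have C0 := min_dist_neq0 dC.
have [c' c'C e] := dcode_attained v C0.
have le3 := covering15 crC dC v; have le : dcode C v <= hd v c by apply: dcode_le.
(* [c] is at distance 2 or 3 from [v], so a codeword within 1 of [v] would be at distance at most 4
   from [c]. *)
have ge2 : 1 < dcode C v.
  rewrite -e ltnNge; apply/negP => le1; move: hw; rewrite hv.
  have [->|n] := eqVneq c c'; first by case: (_ != _); lia.
  have := dC.2 _ _ cC c'C n; have := hd_triangle c v c'; rewrite (hdC c v).
  by case: (_ != _); lia.
rewrite !(ncw_outer crC).
have [->|->] : dcode C v = 2 \/ dcode C v = 3 by lia.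
  by rewrite B22 B23.
by rewrite B33 (outer_lt C).
Qed.

(** Fixing the parity coordinate uses one of the three prescribed values in [NR_unique]; two
    remain. *)
Lemma PN_unique c0 (sigma : {perm 'I_15}) : c0 \in C ->
  exists2 s : {perm 'I_15}, (forall i : 'I_15, i < 2 -> s i = sigma i) &
    [set wperm s (wadd c c0) | c in C] = PN.
Proof.
move=> c0C; have ext_inj := can_inj (@extendK 15).
have cardC : #|[set extend c | c in C]| = 2 ^ 8 by rewrite card_imset // (card15 crC dC).
have [s hs sN] := NR_unique (lift_perm ord0 ord0 sigma) locally_3design_extend cardC (imset_f _ c0C).
have s0 : s ord0 = ord0 by rewrite hs // lift_perm_id.
(* As [s] fixes 0, it permutes the other coordinates, and the default of [odflt] never occurs. *)
pose f k := odflt k (unlift ord0 (s (lift ord0 k))).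
have fE k : lift ord0 (f k) = s (lift ord0 k).
  have : ord0 != s (lift ord0 k) by rewrite -{1}s0 (inj_eq perm_inj) neq_lift.
  by rewrite /f; case/unlift_some => j ej ->.
have f_inj : injective f.
  by move=> j k /(congr1 (lift ord0)); rewrite !fE => /perm_inj /lift_inj.
exists (perm f_inj) => [i hi|].
  by apply: (@lift_inj _ ord0); rewrite permE fE hs // lift_perm_lift.
rewrite /PN -sN -!imset_comp; apply: eq_imset => c /=.
rewrite puncture_behead; apply/ffunP => k.
by rewrite !ffunE permE -fE liftK.
Qed.

End ParityExtension.

Theorem theorem1p1 :
  (forall C : {set word 16}, completely_regular C -> min_dist C 6 ->
     equivalent C NR /\ completely_transitive C) /\
  (forall C : {set word 15}, completely_regular C -> min_dist C 5 ->
     equivalent C PN /\ completely_transitive C).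
Proof.
split=> C crC dC; have C0 := min_dist_neq0 dC.
  have nf c0 sigma := @NR_unique C c0 sigma (locally_3design16 crC dC) (card16 crC dC).
  split; first exact: equivalent_normal_form C0 nf.
  have [_ _ u3 _] := parameters16 crC dC.
  apply: (completely_transitive_normal_form _ C0 nf _ u3 (covering16 crC dC)) => // i hi.
  by apply: (level_inhabited C0 _ dC) => //; lia.
have nf := PN_unique crC dC; split; first exact: equivalent_normal_form C0 nf.
have [_ _ _ u2 _] := parameters15 crC dC.
apply: (completely_transitive_normal_form _ C0 nf _ u2 (covering15 crC dC)) => // i hi.
by apply: (level_inhabited C0 _ dC) => //; lia.
Qed.
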